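(* Let $d\ge 2$ and $a>0$. There exists a real-valued function $g\in(L^1\cap H^1)(\mathbb{R}^d)$ such that $$\limsup_{R\to\infty}\frac{\mathrm{Var}\big(N_{s}(g,R)\big)}{R^{d-2}}=+\infty .$$
   Context: For a fixed $a>0$, $\{\xi_n\}_{n\in\mathbb{Z}^d}$ are independent identically distributed random vectors in $\mathbb{R}^d$ with density $\phi_a(x)=(a\pi)^{-d/2}e^{-|x|^2/a}$ with respect to Lebesgue measure, and $\zeta$ is a random vector uniformly distributed on $[0,1]^d$ and independent of all the $\xi_n$. The stationarized point process is $W_{s}=\{n+\xi_n+\zeta: n\in\mathbb{Z}^d\}$, and its linear statistic with test function $g$ and scale $R>0$ is $N_{s}(g,R)=\sum_{w\in W_s}g(w/R)=\sum_{n\in\mathbb{Z}^d}g\big((n+\xi_n+\zeta)/R\big)$. The variance is $\mathrm{Var}(X)=\mathbb{E}[(X-\mathbb{E}X)^2]$. The Sobolev space $H^1(\mathbb{R}^d)$ consists of the functions $g\in L^2(\mathbb{R}^d)$ whose distributional gradient satisfies $|\nabla g|\in L^2(\mathbb{R}^d)$. *)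

(* Defs.v *)
From HB Require Import structures.
From mathcomp Require Import all_boot all_order all_algebra.
From mathcomp Require Import finmap.
From mathcomp Require Import all_classical all_reals all_analysis.
Import Order.TTheory GRing.Theory Num.Theory.
Import numFieldNormedType.Exports.

Set Implicit Arguments.
Unset Strict Implicit.
Unset Printing Implicit Defensive.

Local Open Scope classical_set_scope.
Local Open Scope ring_scope.

(* Row vectors carry the product sigma-algebra, the one generated by the
   coordinates; for 'rV[R]_n this is the Borel sigma-algebra of R^n. *)
Definition measure_rV_display : measure_display -> measure_display.
Proof. exact. Qed.

Section measurable_rV.
Context {d} {T : measurableType d}.
Variable n : nat.

Definition rV_coord (i : 'I_n) (x : 'rV[T]_n) : T := x ord0 i.

Let rV_set0 : g_sigma_preimage rV_coord set0.
Proof. exact: sigma_algebra0. Qed.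

Let rV_setC A : g_sigma_preimage rV_coord A -> g_sigma_preimage rV_coord (~` A).
Proof. exact: sigma_algebraC. Qed.

Let rV_bigcup (F : _^nat) : (forall i, g_sigma_preimage rV_coord (F i)) ->
  g_sigma_preimage rV_coord (\bigcup_i (F i)).
Proof. exact: sigma_algebra_bigcup. Qed.

HB.instance Definition _ := @isMeasurable.Build (measure_rV_display d)
  'rV[T]_n (g_sigma_preimage rV_coord) rV_set0 rV_setC rV_bigcup.

Lemma measurable_rV_coord (i : 'I_n) : measurable_fun [set: 'rV[T]_n] (rV_coord i).
Proof.
move=> _ Y mY; rewrite setTI; apply: sub_sigma_algebra => /=.
rewrite -bigcup_seq/=; exists i => /=; first by rewrite mem_index_enum.
by exists Y => //; rewrite setTI.
Qed.

Lemma measurable_fun_rVP d1 (T1 : measurableType d1) (f : T1 -> 'rV[T]_n) :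
  measurable_fun [set: T1] f <->
  forall i, measurable_fun [set: T1] (rV_coord i \o f).
Proof.
split=> [mf i|mf].
  by apply: measurableT_comp => //; exact: measurable_rV_coord.
suff H : g_sigma_preimage rV_coord `<=` [set B | measurable (f @^-1` B)].
  by move=> _ A mA; rewrite setTI; exact: H.
apply: smallest_sub; last first.
  rewrite -bigcup_seq/= => _ [i _] [B mB <-].
  by have := mf i measurableT _ mB; rewrite !setTI.
split => /=.
- by rewrite preimage_set0.
- by move=> B mB; rewrite setTD preimage_setC; exact: measurableC.
- by move=> F mF; rewrite preimage_bigcup; exact: bigcup_measurable.
Qed.

End measurable_rV.

Section lebesgue_rV.
Context {R : realType}.

Definition rV_cons n (p : measurableTypeR R * 'rV[R]_n) : 'rV[R]_n.+1 :=
  \row_i oapp (p.2 ord0) p.1 (unlift ord0 i).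

Definition rV_uncons n (x : 'rV[R]_n.+1) : measurableTypeR R * 'rV[R]_n :=
  (x ord0 ord0, \row_i x ord0 (lift ord0 i)).

Lemma rV_unconsK n : cancel (@rV_uncons n) (@rV_cons n).
Proof.
move=> x; apply/rowP => i; rewrite mxE /=.
by case: unliftP => [j|] -> //=; rewrite mxE.
Qed.

Lemma rV_consK n : cancel (@rV_cons n) (@rV_uncons n).
Proof.
case=> x v; congr (_, _); first by rewrite mxE unlift_none.
by apply/rowP => i; rewrite !mxE liftK.
Qed.

Lemma measurable_rV_cons n : measurable_fun setT (@rV_cons n).
Proof.
apply/measurable_fun_rVP => i.
rewrite [X in measurable_fun _ X](_ : _ = fun p : measurableTypeR R * 'rV[R]_n =>
   oapp (p.2 ord0) p.1 (unlift ord0 i)); last first.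
  by apply/funext => p; rewrite /rV_coord /= mxE.
case: unliftP => [j|] _ /=; last exact: measurable_fst.
by apply: (measurableT_comp (measurable_rV_coord j)); exact: measurable_snd.
Qed.

Lemma measurable_rV_uncons n : measurable_fun setT (@rV_uncons n).
Proof.
apply/measurable_fun_pairP; split; first exact: measurable_rV_coord.
apply/measurable_fun_rVP => i.
rewrite [X in measurable_fun _ X](_ : _ = rV_coord (lift ord0 i)).
  exact: measurable_rV_coord.
by apply/funext => x; rewrite /rV_coord /= mxE.
Qed.

Section lebesgue_step.
Variables (n : nat) (mu : {sigma_finite_measure set 'rV[R]_n -> \bar R}).

Let nu := ((@lebesgue_measure R) \x mu)%E.
HB.instance Definition _ := Measure.on nu.

Let nu_sigma_finite : sigma_finite setT nu.
Proof.
have /sigma_finiteP[F [TF ndF Foo]] := sigma_finiteT (@lebesgue_measure R).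
have /sigma_finiteP[G [TG ndG Goo]] := sigma_finiteT mu.
exists (fun k => F k `*` G k).
  rewrite -setXTT TF TG predeqE => -[x y]; split.
    move=> [/= [k _ Fkx] [l _ Gly]]; exists (maxn k l) => //; split.
    - by move: x Fkx; exact/subsetPset/ndF/leq_maxl.
    - by move: y Gly; exact/subsetPset/ndG/leq_maxr.
  by move=> [k _ []/= ? ?]; split; exists k.
move=> k; have [? ?] := Foo k; have [? ?] := Goo k.
split; first exact: measurableX.
by rewrite /nu product_measure1E// lte_mul_pinfty// ge0_fin_numE.
Qed.

Definition lebesgue_rV_succ : set 'rV[R]_n.+1 -> \bar R :=
  pushforward nu (@rV_cons n).

Let lebS0 : lebesgue_rV_succ set0 = 0%E.
Proof. by rewrite /lebesgue_rV_succ /pushforward preimage_set0 measure0. Qed.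

Let lebS_ge0 A : (0 <= lebesgue_rV_succ A)%E.
Proof. by rewrite /lebesgue_rV_succ /pushforward measure_ge0. Qed.

Let lebS_sigma_additive : semi_sigma_additive lebesgue_rV_succ.
Proof.
have mcons (A : set 'rV[R]_n.+1) : measurable A -> measurable (@rV_cons n @^-1` A).
  by move=> mA; rewrite -[X in measurable X]setTI; exact: measurable_rV_cons.
move=> F mF tF mUF; rewrite /lebesgue_rV_succ /pushforward preimage_bigcup.
apply: measure_semi_sigma_additive.
- by move=> k; exact: mcons.
- apply/trivIsetP => /= i j _ _ ij; rewrite -preimage_setI.
  by move/trivIsetP : tF => /(_ _ _ _ _ ij) ->//; rewrite preimage_set0.
- by rewrite -preimage_bigcup; exact: mcons.
Qed.

HB.instance Definition _ := isMeasure.Build _ _ _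
  lebesgue_rV_succ lebS0 lebS_ge0 lebS_sigma_additive.

Let lebS_sigma_finite : sigma_finite setT lebesgue_rV_succ.
Proof.
have [F FT Ffin] := nu_sigma_finite.
exists (fun k => @rV_uncons n @^-1` F k).
  by rewrite -preimage_bigcup -FT preimage_setT.
move=> k; have [mF Foo] := Ffin k; split.
  by rewrite -[X in measurable X]setTI; exact: measurable_rV_uncons.
rewrite /lebesgue_rV_succ /pushforward -comp_preimage.
rewrite (_ : _ \o _ = id) ?preimage_id//.
by apply/funext => p; exact: rV_consK.
Qed.

HB.instance Definition _ := Measure_isSigmaFinite.Build _ _ _
  lebesgue_rV_succ lebS_sigma_finite.

End lebesgue_step.

Fixpoint lebesgue_rV n : {sigma_finite_measure set 'rV[R]_n -> \bar R} :=
  match n with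
  | 0 => dirac (0 : 'rV[R]_0)
  | n'.+1 => lebesgue_rV_succ (lebesgue_rV n')
  end.

Lemma lebesgue_rV_box n (A : 'I_n -> set (measurableTypeR R)) :
  (forall i, measurable (A i)) ->
  lebesgue_rV n [set x | forall i, A i (x ord0 i)] =
  (\prod_(i < n) lebesgue_measure (A i))%E.
Proof.
elim: n A => [|n IH] A mA.
  by rewrite big_ord0 /= diracE mem_set // => -[].
rewrite big_ord_recl -IH //= /lebesgue_rV_succ /pushforward.
have mB : measurable [set x : 'rV[R]_n | forall i, A (lift ord0 i) (x ord0 i)].
  rewrite [X in measurable X](_ : _ =
      \bigcap_i (rV_coord i @^-1` A (lift ord0 i))).
    apply: fin_bigcap_measurable => [|i _]; first exact: finite_finset.
    by rewrite -[X in measurable X]setTI; apply: measurable_rV_coord => //; exact: mA.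
  by apply/seteqP; split=> x /= H i; [move=> _|]; exact: H.
rewrite -product_measure1E //; congr product_measure1.
apply/seteqP; split=> [[x v] /= H|[x v] /= [Ax Av] i].
  split=> [|i]; first by have := H ord0; rewrite mxE unlift_none.
  by have := H (lift ord0 i); rewrite mxE liftK.
by rewrite mxE; case: unliftP => [j|] -> /=.
Qed.

End lebesgue_rV.

Section sobolev.
Context {R : realType} {d : nat}.
Implicit Types f g : 'rV[R]_d -> R.

Definition partial (i : 'I_d) f : 'rV[R]_d -> R := 'D_(delta_mx ord0 i) f.

Fixpoint continuously_diff (k : nat) f : Prop :=
  continuous f /\
  match k with
  | 0 => True
  | k'.+1 => forall i : 'I_d,
      (forall x, derivable f x (delta_mx ord0 i)) /\
      continuously_diff k' (partial i f)
  end.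

Definition test_function f : Prop :=
  (forall k, continuously_diff k f) /\ compact (closure [set x | f x != 0]).

(* The integrals are real-valued; they are meaningful when g and h are locally
   integrable, as is the case for the square-integrable functions below. *)
Definition weak_partial (i : 'I_d) g (h : 'rV[R]_d -> R) : Prop :=
  forall phi, test_function phi ->
    \int[lebesgue_rV d]_x (g x * partial i phi x) =
    - \int[lebesgue_rV d]_x (h x * phi x).

(* The norm of the matrix library on 'rV[R]_d is the sup norm, hence the
   explicit Euclidean norm. *)
Definition enorm (x : 'rV[R]_d) : R := Num.sqrt (\sum_i x ord0 i ^+ 2).

Definition sobolev_H1 g : Prop :=
  g \in Lfun (lebesgue_rV d) 2%:E /\
  exists Dg : 'rV[R]_d -> 'rV[R]_d,
    [/\ measurable_fun setT Dg,
        (fun x => enorm (Dg x)) \in Lfun (lebesgue_rV d) 2%:E &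
        forall i : 'I_d, weak_partial i g (fun x => Dg x ord0 i)].

End sobolev.

Section model.
Context {R : realType} {d : nat}.

Definition gaussian_density (a : R) (x : 'rV[R]_d) : R :=
  (a * pi) `^ (- (d%:R / 2)) * expR (- (enorm x ^+ 2 / a)).

Definition unit_cube : set 'rV[R]_d := [set x | forall i, 0 <= x ord0 i <= 1].

Definition mutually_independent {disp disp'} {Omega : measurableType disp}
    {T : measurableType disp'} (P : probability Omega R) (I : choiceType)
    (X : I -> Omega -> T) : Prop :=
  forall (J : {fset I}) (A : I -> set T), (forall i, measurable (A i)) ->
    P (\bigcap_(i in [set` J]) (X i @^-1` A i)) =
    (\prod_(i <- J) P (X i @^-1` A i))%E.

Context {disp : measure_display} {Omega : measurableType disp}.

(* Index Some n stands for xi_n and None for zeta: joint independence of this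
   family says that the xi_n are independent and that zeta is independent of
   (xi_n)_n. *)
Definition noise_family {P : probability Omega R}
    (xi : 'rV[int]_d -> {RV P >-> 'rV[R]_d}) (zeta : {RV P >-> 'rV[R]_d})
    (o : option 'rV[int]_d) : Omega -> 'rV[R]_d :=
  if o is Some n then xi n else zeta.

Record stationarized_gaussian_lattice (a : R) (P : probability Omega R)
    (xi : 'rV[int]_d -> {RV P >-> 'rV[R]_d})
    (zeta : {RV P >-> 'rV[R]_d}) : Prop := {
  xi_law : forall n (A : set 'rV[R]_d), measurable A ->
    P (xi n @^-1` A) =
    (\int[lebesgue_rV d]_(x in A) (gaussian_density a x)%:E)%E ;
  zeta_law : forall A : set 'rV[R]_d, measurable A ->
    P (zeta @^-1` A) = lebesgue_rV d (A `&` unit_cube) ;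
  noise_indep : mutually_independent P (noise_family xi zeta) }.

(* esum only sums nonnegative families, so the (almost surely absolutely
   convergent, when g is integrable) series over Z^d is the difference of the
   sums of its positive and negative parts. *)
Definition linear_statistic {P : probability Omega R}
    (xi : 'rV[int]_d -> {RV P >-> 'rV[R]_d}) (zeta : {RV P >-> 'rV[R]_d})
    (g : 'rV[R]_d -> R) (r : R) (w : Omega) : R :=
  let f (n : 'rV[int]_d) : \bar R :=
    (g (r^-1 *: (map_mx intr n + xi n w + zeta w)))%:E in
  fine (\esum_(n in setT) f^\+%E n - \esum_(n in setT) f^\-%E n)%E.

End model.

(* Main.v *)
(** Conditioning on [zeta] and testing against the character [cos (2 pi zeta_0)]
    gives, since that character has mean zero and modulus at most one,
      Var (N(g, r)) >= (r^d * kappa * ghat_c(r))^2,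
    where [ghat_c(r) = \int g(v) cos (2 pi r v_0) dv] and [kappa > 0] is the
    corresponding Fourier coefficient of the Gaussian: the sum over the lattice
    turns the unit cube into R^d.  A function of H^1 may have a Fourier transform
    that is much larger than |k|^{-(d+2)/2} at a sparse set of points of the ray
    R e_0.  We take the tensor power of
      f(x) = 8^-j (1 - cos (2 pi 4^j x))  on [j, j+1),  j = 0, 1, 2, ...
    Each piece vanishes at the end points, so f is continuous, and
    |f'| <= 2 pi 2^-j on [j, j+1), so f' is integrable and bounded.  At the
    frequency r = 4^k only the k-th piece contributes, with -8^-k / 2; hence
    Var / r^(d-2) >= const * r^(d+2) * 64^-k >= const * 4^k. *)

Require Import Defs.
From HB Require Import structures.
From mathcomp Require Import all_boot all_order all_algebra.
From mathcomp Require Import finmap ring lra.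
From mathcomp Require Import all_classical all_reals all_analysis.
From mathcomp Require Import measurable_realfun.
Import Order.TTheory GRing.Theory Num.Theory.
Import numFieldNormedType.Exports.

Set Implicit Arguments.
Unset Strict Implicit.
Unset Printing Implicit Defensive.

Local Open Scope classical_set_scope.
Local Open Scope ring_scope.

(** * Densities and countable sums *)

Section density.
Local Open Scope ereal_scope.
Context d (T : measurableType d) (R : realType).
Import HBNNSimple.

(** Signed integrands are kept out of the probabilistic part. [profile] is nonnegative and the
    character enters through weights 1 + e cos with 0 <= e <= 1, so every integrand on the way from
    the lattice sum to one-dimensional integrals is nonnegative. Sums, expectations and Lebesgue
    integrals are then exchanged by Tonelli before anything is known to be finite, and the
    covariance is read off as the difference of the cases e = 1 and e = 0.

    The numbers 4 and 8 balance two demands. Differentiation multiplies the j-th amplitude by 4^j,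
    and 8^-j 4^j = 2^-j must remain summable for H^1. At r = 4^k the squared amplitude is 64^-k =
    r^-3, so the variance is at least of order r^(2d-3); division by r^(d-2) leaves r^(d-1), which
    is at least r because d >= 2.

    Only the positivity of the Gaussian coefficient enters the bound, so it is deduced from a linear
    differential equation and not from a closed formula. *)

Lemma ge0_integral_density (mu nu : {measure set T -> \bar R}) (p : T -> R)
    (f : T -> \bar R) :
  measurable_fun setT p -> (forall x, 0 <= p x)%R ->
  (forall A, measurable A -> nu A = \int[mu]_(x in A) (p x)%:E) ->
  measurable_fun setT f -> (forall x, 0 <= f x) ->
  \int[nu]_x f x = \int[mu]_x (f x * (p x)%:E).
Proof.
move=> mp p0 nuE mf f0.
pose f_ := nnsfun_approx measurableT mf.
have f_f x : (EFin \o f_ ^~ x) n @[n --> \oo] --> f x.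
  by apply: cvg_nnsfun_approx => // y _; exact: f0.
have nd x : {homo (fun n => (f_ n x)%:E) : n m / (n <= m)%N >-> n <= m}.
  by move=> n m nm; rewrite lee_fin; exact/lefP/nd_nnsfun_approx.
transitivity (limn (fun n => \int[nu]_x (f_ n x)%:E)).
  rewrite -monotone_convergence//.
  - by apply: eq_integral => x _; apply/esym/cvg_lim => //; exact: f_f.
  - by move=> n; exact/measurable_EFinP/measurable_funP.
  - by move=> n x _; rewrite lee_fin.
transitivity (limn (fun n => \int[mu]_x ((f_ n x)%:E * (p x)%:E))); last first.
  rewrite -monotone_convergence//.
  - apply: eq_integral => x _; apply/cvg_lim => //.
    by apply: cvgeZr => //; exact: f_f.
  - move=> n; apply: emeasurable_funM => //; last exact/measurable_EFinP.
    exact/measurable_EFinP/measurable_funP.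
  - by move=> n x _; rewrite mule_ge0// lee_fin.
  - by move=> x _ n m nm; rewrite lee_wpmul2r ?lee_fin//; exact: nd.
congr (limn _); apply/funext => n.
have mfn (r : R) : measurable (f_ n @^-1` [set r]) by exact: measurable_sfunP.
transitivity (\sum_(k \in range (f_ n))
    \int[nu]_x (k * \1_(f_ n @^-1` [set k]) x)%:E).
  under eq_integral do rewrite fimfunE -fsumEFin//.
  rewrite ge0_integral_fsum//; last first.
    by move=> y x _; rewrite nnfun_muleindic_ge0.
  by move=> y; exact/measurable_EFinP/measurable_funM.
transitivity (\sum_(k \in range (f_ n))
    \int[mu]_x ((k * \1_(f_ n @^-1` [set k]) x)%:E * (p x)%:E)); last first.
  rewrite -ge0_integral_fsum//; last 2 first.
  - move=> y; apply: emeasurable_funM; last exact/measurable_EFinP.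
    exact/measurable_EFinP/measurable_funM.
  - by move=> y x _; rewrite mule_ge0 ?lee_fin// -lee_fin nnfun_muleindic_ge0.
  apply: eq_integral => x _; rewrite [in RHS]fimfunE -fsumEFin//.
  rewrite ge0_mule_fsuml// => i.
  by rewrite nnfun_muleindic_ge0.
apply: eq_fsbigr => k; rewrite inE => -[x _ <-].
rewrite integralZl_indic_nnsfun// integral_indic// setIT nuE//.
rewrite integral_mkcond -ge0_integralZl//=; last 3 first.
- by apply/measurable_restrict => //; rewrite setTI; apply/measurable_EFinP/measurable_funTS.
- by move=> y _; rewrite patchE; case: ifPn; rewrite ?lee_fin.
- by rewrite lee_fin.
apply: eq_integral => y _; rewrite patchE indicE; case: ifPn => _.
  by rewrite mulr1.
by rewrite mulr0 mule0 mul0e.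
Qed.
End density.

(** Enumerating [I] by [pickle_inv], with 0 at the numbers that code no element, gives access to the
    theorems on series over the natural numbers, above all the exchange with the integral. *)
Lemma esum_nneseries (R : realType) (I : countType) (a : I -> \bar R) :
  (forall i, 0 <= a i)%E ->
  (\esum_(i in setT) a i =
   \sum_(k <oo) (if @pickle_inv I k is Some i then a i else 0))%E.
Proof.
move=> a0; rewrite nneseries_esumT; last by move=> k; case: pickle_inv.
transitivity (\esum_(k in range (@choice.pickle I))
    (if @pickle_inv I k is Some i then a i else 0))%E.
  rewrite (@reindex_esum R I nat setT (range (@choice.pickle I)) choice.pickle); last first.
    by split => // x y _ _; exact: (pcan_inj pickleK_inv).
  by apply: eq_esum => i _; rewrite pickleK_inv.
rewrite esum_mkcond; apply: eq_esum => k _.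
case: ifPn => // /negP h.
case E: (@pickle_inv I k) => [i|//].
exfalso; apply: h; rewrite inE; exists i => //.
by have := @pickle_invK I k; rewrite /ocancel E.
Qed.

Lemma ge0_esumZr (R : realType) (I : countType) (a : I -> \bar R) (c : R) :
  (forall i, 0 <= a i)%E -> 0 <= c ->
  (\esum_(i in setT) (a i * c%:E) = (\esum_(i in setT) a i) * c%:E)%E.
Proof.
move=> a0 c0; rewrite !esum_nneseries//; last by move=> i; rewrite mule_ge0// lee_fin.
rewrite muleC -nneseriesZl; last by move=> k _; case: pickle_inv.
by apply: eq_eseriesr => k _; case: pickle_inv => [i|]; rewrite ?mule0// muleC.
Qed.

Lemma ge0_integral_esum d (T : measurableType d) (R : realType) (I : countType)
    (mu : {measure set T -> \bar R}) (f : I -> T -> \bar R) :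
  (forall i, measurable_fun setT (f i)) -> (forall i x, 0 <= f i x)%E ->
  measurable_fun setT (fun x => \esum_(i in setT) f i x)%E /\
  (\int[mu]_x (\esum_(i in setT) f i x) = \esum_(i in setT) \int[mu]_x f i x)%E.
Proof.
move=> mf f0.
pose F k x := if @pickle_inv I k is Some i then f i x else 0%E.
have F0 k x : (0 <= F k x)%E by rewrite /F; case: pickle_inv.
have mF k : measurable_fun setT (F k) by rewrite /F; case: pickle_inv.
have EF x : (\esum_(i in setT) f i x = \sum_(k <oo) F k x)%E by rewrite esum_nneseries.
split.
  rewrite (_ : (fun x => _) = fun x => \sum_(k <oo) F k x)%E; last exact/funext.
  by apply: ge0_emeasurable_sum.
under eq_integral do rewrite EF.
rewrite integral_nneseries// esum_nneseries; last by move=> i; exact: integral_ge0.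
apply: eq_eseriesr => k _; rewrite /F; case: pickle_inv => //.
by rewrite integral0.
Qed.

(** * Integration on row vectors *)

Section rV.
Context {R : realType}.
Local Notation leb := (@lebesgue_measure R).

Lemma measurable_rV_compl n (q : R -> R) (i : 'I_n) :
  measurable_fun setT q ->
  measurable_fun setT (fun x : 'rV[R]_n => q (x ord0 i)).
Proof.
move=> mq; apply: (@measurableT_comp _ _ _ _ _ _ q _ (rV_coord i)) => //.
exact: measurable_rV_coord.
Qed.

Lemma ge0_integral_rV_succ n (F : 'rV[R]_n.+1 -> \bar R) :
  measurable_fun setT F -> (forall x, 0 <= F x)%E ->
  (\int[lebesgue_rV n.+1]_x F x =
   \int[leb]_t \int[lebesgue_rV n]_v F (rV_cons (t, v)))%E.
Proof.
move=> mF F0.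
rewrite (ge0_integral_pushforward (@measurable_rV_cons R n))//.
rewrite preimage_setT fubini_tonelli1//=.
by apply: measurableT_comp => //; exact: measurable_rV_cons.
Qed.

Lemma measurable_rV_prod n (q : 'I_n -> R -> R) :
  (forall i, measurable_fun setT (q i)) ->
  measurable_fun setT (fun x : 'rV[R]_n => \prod_(i < n) q i (x ord0 i)).
Proof.
move=> mq; apply: measurable_prod => i _; exact: measurable_rV_compl.
Qed.

Lemma rV_cons0 n (t : R) (v : 'rV[R]_n) : rV_cons (t, v) ord0 ord0 = t.
Proof. by rewrite mxE unlift_none. Qed.

Lemma rV_consS n (t : R) (v : 'rV[R]_n) i :
  rV_cons (t, v) ord0 (lift ord0 i) = v ord0 i.
Proof. by rewrite mxE liftK. Qed.

Lemma ge0_integral_rV_prod n (q : 'I_n -> R -> R) :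
  (forall i, measurable_fun setT (q i)) -> (forall i x, 0 <= q i x) ->
  (\int[lebesgue_rV n]_x (\prod_(i < n) q i (x ord0 i))%:E =
   \prod_(i < n) \int[leb]_t (q i t)%:E)%E.
Proof.
elim: n q => [|n IH] q mq q0.
  rewrite big_ord0; under eq_integral do rewrite big_ord0.
  by rewrite integral_cst//= diracT mule1.
rewrite ge0_integral_rV_succ; last 2 first.
- apply/measurable_EFinP; exact: measurable_rV_prod.
- by move=> x; rewrite lee_fin prodr_ge0.
rewrite big_ord_recl -IH//.
rewrite -ge0_integralZr//; last 3 first.
- exact: ((measurable_EFinP _ (q ord0)).2 (mq ord0)).
- by move=> x _; rewrite lee_fin.
- by apply: integral_ge0 => x _; rewrite lee_fin prodr_ge0.
apply: eq_integral => t _.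
rewrite -ge0_integralZl//; last 3 first.
- by apply/measurable_EFinP; apply: (@measurable_rV_prod n (fun i => q (lift ord0 i))) => i; exact: mq.
- by move=> x _; rewrite lee_fin prodr_ge0.
- by rewrite lee_fin.
apply: eq_integral => v _.
rewrite big_ord_recl rV_cons0 -EFinM; congr (_ * _)%:E.
by apply: eq_bigr => i _; rewrite rV_consS.
Qed.

(** The image of Lebesgue measure under [h], multiplied by [r], gives each interval []a, b]] its
    length, and this characterizes Lebesgue measure. *)
Lemma ge0_integral_affine (r c : R) (f : R -> \bar R) : 0 < r ->
  measurable_fun setT f -> (forall x, 0 <= f x)%E ->
  (\int[leb]_x f x = r%:E * \int[leb]_x f (r * x + c)%R)%E.
Proof.
move=> r0 mf f0.
pose h : measurableTypeR R -> measurableTypeR R := fun x => r * x + c.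
have mh : measurable_fun setT h.
  by apply: measurable_funD => //; apply: measurable_funM.
have hE (A : set (measurableTypeR R)) : measurable A ->
    leb A = mscale (NngNum (ltW r0)) (pushforward leb h) A.
  move=> mA; apply: lebesgue_measure_unique => // _ [[a b]] _ <-.
  transitivity (r%:E * leb (h @^-1` `]a, b]))%E; last by [].
  rewrite (_ : h @^-1` _ = `](a - c) / r, (b - c) / r]%classic); last first.
    apply/seteqP; split => x /=; rewrite /h !in_itv/= ltr_pdivrMr// ler_pdivlMr//;
    by rewrite ltrBlDr lerBrDr mulrC.
  rewrite !lebesgue_measure_itv/= !lte_fin ltr_pM2r ?invr_gt0// ltrD2r.
  case: ifPn => ab; last by rewrite mule0.
  by rewrite -!EFinB -EFinM; congr EFin; field; rewrite gt_eqF.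
rewrite (eq_measure_integral (mscale (NngNum (ltW r0)) (pushforward leb h))); last first.
  by move=> A mA _; exact: hE.
rewrite ge0_integral_mscale//=; congr (_ * _)%E.
by rewrite (ge0_integral_pushforward mh)//.
Qed.
End rV.

(** * Functions defined piecewise on the intervals [j, j+1) *)

Section blocks.
Context {R : realType}.
Local Notation leb := (@lebesgue_measure R).

Lemma measurable_funTS_EFin (D : set (measurableTypeR R)) (q : R -> R) :
  measurable_fun setT q -> measurable_fun D (fun x => (q x)%:E).
Proof. by move=> mq; apply: measurable_funTS; apply/measurable_EFinP. Qed.

Definition block (j : nat) : set R := `[j%:R, j.+1%:R[%classic.

(** The test [0 <= x] matters: [Num.truncn] is 0 on negative numbers, where the piece of index 0
    must not be continued. *)
Definition blockwise (q : nat -> R -> R) (x : R) : R :=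
  if 0 <= x then q (Num.truncn x) x else 0.

Lemma blockwise_lt0 q x : x < 0 -> blockwise q x = 0.
Proof. by rewrite /blockwise leNgt => ->. Qed.

Lemma truncn_block j (x : R) : block j x -> Num.truncn x = j.
Proof. by move=> xj; apply: truncn_def; rewrite /block/= in_itv/= in xj. Qed.

Lemma blockwise_block q j x : block j x -> blockwise q x = q j x.
Proof.
move=> xj; rewrite /blockwise (truncn_block xj).
by move: xj; rewrite /block/= in_itv/= => /andP[jx _]; rewrite (le_trans _ jx).
Qed.

Lemma measurable_block j : measurable (block j).
Proof. exact: measurable_itv. Qed.

Lemma trivIset_block : trivIset setT block.
Proof.
apply/trivIsetP => i j _ _ /eqP ij; apply/seteqP; split => // x [xi xj].
by apply: ij; rewrite -(truncn_block xi) -(truncn_block xj).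
Qed.

Lemma bigcup_block : \bigcup_j block j = `[0, +oo[%classic.
Proof.
apply/seteqP; split => [x [j _]|x]; rewrite /block/= !in_itv/= ?andbT.
  by move=> /andP[jx _]; rewrite (le_trans _ jx).
move=> x0; exists (Num.truncn x) => //; rewrite /block/= in_itv/=.
exact: truncn_itv.
Qed.

Lemma measurable_blockwise q :
  (forall j, measurable_fun setT (q j)) -> measurable_fun setT (blockwise q).
Proof.
move=> mq.
have -> : [set: R] = `]-oo, 0[%classic `|` \bigcup_j block j.
  by rewrite bigcup_block -itv_bndbnd_setU// ?bnd_simp// set_itvE.
apply/measurable_funU; [exact: measurable_itv|
  by apply: bigcup_measurable => j _; exact: measurable_block|split].
  apply: (eq_measurable_fun (cst (0 : R))).
    by move=> x; rewrite inE/= in_itv/= => /blockwise_lt0 ->.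
  exact: measurable_cst.
apply/measurable_fun_bigcup; first by move=> j; exact: measurable_block.
move=> j; apply: (eq_measurable_fun (q j)); last exact: measurable_funTS.
by move=> x; rewrite inE => /(blockwise_block q) ->.
Qed.

Lemma integral_setT_pos (F : R -> \bar R) : (forall x, x < 0 -> F x = 0%E) ->
  (\int[leb]_x F x = \int[leb]_(x in \bigcup_j block j) F x)%E.
Proof.
move=> F0; rewrite bigcup_block [RHS]integral_mkcond; apply: eq_integral => x _.
rewrite patchE; case: ifPn => //; rewrite notin_setE/= in_itv/= andbT => /negP.
by rewrite -ltNge => /F0.
Qed.

(** The blocks are half-open in order to partition the half-line; the closed intervals on the right
    are the form to which the fundamental theorem of calculus applies. *)
Lemma ge0_integral_blockwise q : (forall j, measurable_fun setT (q j)) ->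
  (forall x, 0 <= blockwise q x) ->
  (\int[leb]_x (blockwise q x)%:E =
   \sum_(j <oo) \int[leb]_(x in `[j%:R, j.+1%:R]) (q j x)%:E)%E.
Proof.
move=> mq q0; rewrite integral_setT_pos; last by move=> x /blockwise_lt0 ->.
rewrite ge0_integral_bigcup//; last 4 first.
- exact: measurable_block.
- by apply: measurable_funTS_EFin; exact: measurable_blockwise.
- by move=> x _; rewrite lee_fin.
- exact: trivIset_block.
apply: eq_eseriesr => j _.
rewrite -integral_itv_bndo_bndc; last first.
  exact: measurable_funTS_EFin.
by apply: eq_integral => x; rewrite inE => /(blockwise_block q) ->.
Qed.

(** Counterpart for integrands of any sign. A single [F] evaluated at the integers encodes that
    consecutive primitives agree at the common end point, so that the increments telescope. *)
Lemma integral_blockwise_telescope (q : nat -> R -> R) (h F : R -> R) (l : R) :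
  leb.-integrable setT (EFin \o h) -> (forall x, x < 0 -> h x = 0) ->
  (forall j x, block j x -> h x = q j x) ->
  (forall j, measurable_fun setT (q j)) ->
  (forall j, \int[leb]_(x in `[j%:R, j.+1%:R]) (q j x)%:E =
     (F j.+1%:R - F j%:R)%:E)%E ->
  F n%:R @[n --> \oo] --> l ->
  (\int[leb]_x (h x)%:E = (l - F 0)%:E)%E.
Proof.
move=> ih h0 hq mq qF Fl; rewrite integral_setT_pos; last by move=> x /h0 ->.
rewrite integral_bigcup; last 3 first.
- exact: trivIset_block.
- exact: measurable_block.
- apply: integrableS ih => //; first exact: bigcup_measurable (fun j _ => measurable_block j).
rewrite (eq_eseriesr (g := fun j => (F j.+1%:R - F j%:R)%:E)); last first.
  move=> j _; rewrite -qF -integral_itv_bndo_bndc; last first.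
    exact: measurable_funTS_EFin.
  by apply: eq_integral => x; rewrite inE => /hq ->.
apply/cvg_lim => //.
rewrite (_ : (fun n => _) = fun n => (F n%:R - F 0)%:E); last first.
  apply/funext => n; rewrite sumEFin; congr EFin.
  by rewrite (@telescope_sumr _ 0 n (fun j => F j%:R)).
apply: cvg_EFin; first exact: nearW.
by apply: cvgB => //; exact: cvg_cst.
Qed.

Lemma FTC2_is_derive (f F : R -> R) (a b : R) : a < b -> continuous f ->
  (forall x : R, is_derive x 1 F (f x)) ->
  (\int[leb]_(x in `[a, b]) (f x)%:E = (F b - F a)%:E)%E.
Proof.
move=> ab cf dF.
have cF : continuous F.
  by move=> x; apply/differentiable_continuous/derivable1_diffP; have [] := dF x.
rewrite (@continuous_FTC2 R f F)//.
- exact: continuous_subspaceT.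
- split => [x _||].
  + by have [] := dF x.
  + exact/cvg_at_right_filter/cF.
  + exact/cvg_at_left_filter/cF.
- by move=> x _; rewrite derive1E; have [_ ->] := dF x.
Qed.

End blocks.

(** * The one-dimensional profile and its Fourier coefficients *)

Section profile.
Context {R : realType}.
Local Notation leb := (@lebesgue_measure R).

Lemma is_derive_cos_affine (m c x : R) :
  is_derive x 1 (fun v => cos (m * v + c)) (- (m * sin (m * x + c))).
Proof.
have H : is_derive x 1 (fun v : R => m * v + c) m.
  by apply: is_derive_eq; rewrite /GRing.scale/= mulr1 addr0.
have := @is_derive1_comp R cos (fun v => m * v + c) x _ _ (is_derive_cos _) H.
by rewrite mulNr mulrC.
Qed.

Lemma is_derive_sin_affine (m c x : R) :
  is_derive x 1 (fun v => sin (m * v + c)) (m * cos (m * x + c)).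
Proof.
have H : is_derive x 1 (fun v : R => m * v + c) m.
  by apply: is_derive_eq; rewrite /GRing.scale/= mulr1 addr0.
have := @is_derive1_comp R sin (fun v => m * v + c) x _ _ (is_derive_sin _) H.
by rewrite mulrC.
Qed.

Lemma continuous_cos_affine (m c : R) : continuous (fun v => cos (m * v + c)).
Proof.
move=> x; apply/differentiable_continuous/derivable1_diffP.
by have [] := is_derive_cos_affine m c x.
Qed.

Lemma continuous_sin_affine (m c : R) : continuous (fun v => sin (m * v + c)).
Proof.
move=> x; apply/differentiable_continuous/derivable1_diffP.
by have [] := is_derive_sin_affine m c x.
Qed.

Definition wave (N : int) (c v : R) : R := cos (N%:~R * (pi *+ 2) * v + c).

(** The frequency 0 is separated because the usual primitive would divide by it. *)
Definition wave_prim (N : int) (c v : R) : R :=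
  if N == 0 then cos c * v else sin (N%:~R * (pi *+ 2) * v + c) / (N%:~R * (pi *+ 2)).

Lemma pi2_gt0 : 0 < pi *+ 2 :> R. Proof. by rewrite pmulrn_rgt0// pi_gt0. Qed.

Lemma continuous_wave N c : continuous (wave N c).
Proof. exact: continuous_cos_affine. Qed.

Lemma is_derive_wave_prim N c (x : R) : is_derive x 1 (wave_prim N c) (wave N c x).
Proof.
rewrite /wave_prim /wave; case: eqVneq => [->|N0].
  rewrite !mul0r add0r; apply: is_derive_eq.
  by rewrite /GRing.scale/= ?(mulr1, mulr0, addr0, add0r).
rewrite (_ : (fun _ => _) = (N%:~R * (pi *+ 2))^-1 \*:
    (fun v => sin (N%:~R * (pi *+ 2) * v + c))); last first.
  by apply/funext => v/=; rewrite mulrC.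
have := is_derive_sin_affine (N%:~R * (pi *+ 2)) c x => H.
apply: is_derive_eq.
rewrite /GRing.scale/= mulrA mulVf ?mul1r// mulf_neq0 ?intr_eq0//.
by rewrite gt_eqF// pi2_gt0.
Qed.

Lemma periodicz (f : R -> R) (T : R) : periodic f T ->
  forall (n : int) x, f (x + T *~ n) = f x.
Proof.
move=> pf [n|n] x; first by rewrite -pmulrn periodicn.
by rewrite NegzE mulrNz -pmulrn -{2}(subrK (T *+ n.+1) x) (periodicn pf).
Qed.

(** Over a block the argument advances by [N] full turns, so only the constant wave has a mean. This
    is the orthogonality of characters in the form used below. *)
Lemma wave_prim_block N c (j : nat) :
  wave_prim N c j.+1%:R - wave_prim N c j%:R = if N == 0 then cos c else 0.
Proof.
rewrite /wave_prim; case: eqVneq => [_|N0].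
  by rewrite -mulrBr -natr1 addrAC subrr add0r mulr1.
rewrite -mulrBl [X in X / _](_ : _ = 0) ?mul0r//.
have -> : N%:~R * (pi *+ 2) * j.+1%:R + c =
    N%:~R * (pi *+ 2) * j%:R + c + (pi *+ 2) *~ N by rewrite -mulrzr -natr1; ring.
by rewrite periodicz ?subrr//; exact: sinD2pi.
Qed.

Definition profile_piece (j : nat) (v : R) : R :=
  8^-1 ^+ j * (1 - wave ((4 ^ j)%N : int) 0 v).
Definition profile := blockwise profile_piece.
Definition dprofile_piece (j : nat) (v : R) : R :=
  2^-1 ^+ j * (pi *+ 2) * sin (((4 ^ j)%N : int)%:~R * (pi *+ 2) * v + 0).
Definition dprofile := blockwise dprofile_piece.
(** A common majorant: up to constants it dominates both [profile] and [dprofile], and it is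
    integrable and at most 1. *)
Definition envelope_piece (j : nat) (v : R) : R := 2^-1 ^+ j.
Definition envelope := blockwise envelope_piece.

Lemma measurable_profile_piece j : measurable_fun setT (profile_piece j).
Proof.
apply: measurable_funM => //; apply: measurable_funB => //.
by apply: continuous_measurable_fun; exact: continuous_wave.
Qed.

Lemma measurable_profile : measurable_fun setT profile.
Proof. by apply: measurable_blockwise => j; exact: measurable_profile_piece. Qed.

Lemma continuous_dprofile_piece j : continuous (dprofile_piece j).
Proof.
by move=> x; apply: cvgM; [exact: cvg_cst|exact: continuous_sin_affine].
Qed.

Lemma measurable_dprofile_piece j : measurable_fun setT (dprofile_piece j).
Proof. by apply: continuous_measurable_fun; exact: continuous_dprofile_piece. Qed.

Lemma measurable_dprofile : measurable_fun setT dprofile.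
Proof. by apply: measurable_blockwise => j; exact: measurable_dprofile_piece. Qed.

Lemma measurable_envelope : measurable_fun setT envelope.
Proof. by apply: measurable_blockwise => j; exact: measurable_cst. Qed.

Lemma blockwiseP (P : R -> Prop) (q : nat -> R -> R) x :
  P 0 -> (forall j, P (q j x)) -> P (blockwise q x).
Proof. by rewrite /blockwise; case: ifP. Qed.

Lemma envelope_ge0 x : 0 <= envelope x.
Proof. by apply: (@blockwiseP (fun y : R => 0 <= y) envelope_piece) => // j; rewrite exprn_ge0. Qed.

Lemma envelope_le1 x : envelope x <= 1.
Proof.
apply: (@blockwiseP (fun y : R => y <= 1) envelope_piece) => // j.
by rewrite exprn_ile1// invf_le1// ler1n.
Qed.

Lemma wave_le1 N c v : wave N c v <= 1. Proof. exact: cos_le1. Qed.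

Lemma profile_ge0 x : 0 <= profile x.
Proof.
apply: (@blockwiseP (fun y : R => 0 <= y) profile_piece) => // j.
by rewrite mulr_ge0 ?exprn_ge0// subr_ge0 wave_le1.
Qed.

Lemma profile_le_envelope x : profile x <= 2 * envelope x.
Proof.
rewrite /profile /envelope /blockwise; case: ifP => _; last by rewrite mulr0.
rewrite mulrC; apply: ler_pM; rewrite ?exprn_ge0 ?subr_ge0 ?wave_le1//.
  by rewrite lerXn2r ?nnegrE// lef_pV2 ?posrE// ler_nat.
by rewrite lerBlDr -lerBlDl (_ : 1 - 2 = -1) ?cos_geN1//; ring.
Qed.

Lemma norm_dprofile_le_envelope x : `|dprofile x| <= pi *+ 2 * envelope x.
Proof.
rewrite /dprofile /envelope /blockwise; case: ifP => _; last by rewrite normr0 mulr0.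
have h : 0 <= 2^-1 ^+ Num.truncn x * (pi *+ 2) :> R.
  by rewrite mulr_ge0 ?exprn_ge0// ltW// pi2_gt0.
by rewrite normrM (ger0_norm h) [leRHS]mulrC ler_piMr// sin_max.
Qed.

Lemma is_derive_profile_piece j (x : R) :
  is_derive x 1 (profile_piece j) (dprofile_piece j x).
Proof.
have H := is_derive_cos_affine (((4 ^ j)%N : int)%:~R * (pi *+ 2)) 0 x.
rewrite (_ : profile_piece j = 8^-1 ^+ j \*: (cst 1 -
    (fun v => cos (((4 ^ j)%N : int)%:~R * (pi *+ 2) * v + 0)))); last first.
  by apply/funext => v.
apply: is_derive_eq; rewrite /GRing.scale/= sub0r opprK /dprofile_piece.
rewrite (_ : 2^-1 ^+ j = 8^-1 ^+ j * ((4 ^ j)%N : int)%:~R :> R); last first.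
  by rewrite -pmulrn natrX -exprMn; congr (_ ^+ _); field.
by ring.
Qed.

Lemma profile_piece_nat j (n : nat) : profile_piece j n%:R = 0.
Proof.
rewrite /profile_piece /wave -pmulrn (_ : _ + 0 = 0 + (pi *+ 2) *+ (4 ^ j * n)).
  by rewrite (periodicn (@cosD2pi R)) cos0 subrr mulr0.
by rewrite add0r -[RHS](mulr_natr (pi *+ 2)) natrM; ring.
Qed.

(** The constant 8/7 is the sum of 8^-j, the mass of the profile. The weight is nonnegative because
    [|e| <= 1], so the integral may be computed block by block. *)
Lemma integral_profile_wave (k : nat) (e y : R) : `|e| <= 1 ->
  (\int[leb]_v (profile v * (1 + e * wave ((4 ^ k)%N : int) (- y) v))%:E =
   (8 / 7 - e * (8^-1 ^+ k * cos y / 2))%:E)%E.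
Proof.
move=> e1.
pose q j v := profile_piece j v * (1 + e * wave ((4 ^ k)%N : int) (- y) v).
have -> : (fun v => (profile v * (1 + e * wave ((4 ^ k)%N : int) (- y) v))%:E) =
    (fun v => (blockwise q v)%:E).
  apply/funext => v; congr EFin; rewrite /profile /blockwise.
  by case: ifP => // _; rewrite mul0r.
have cq j : continuous (q j).
  move=> v; apply: cvgM.
    apply: cvgM; first exact: cvg_cst.
    by apply: cvgB; [exact: cvg_cst|exact: continuous_wave].
  apply: cvgD; first exact: cvg_cst.
  by apply: cvgM; [exact: cvg_cst|exact: continuous_wave].
have q0 x : 0 <= blockwise q x.
  apply: (@blockwiseP (fun y : R => 0 <= y) q) => // j; apply: mulr_ge0.
    by rewrite mulr_ge0 ?exprn_ge0// subr_ge0 wave_le1.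
  rewrite -lerBlDl sub0r; apply: (@le_trans _ _ (- `|e * wave (4 ^ k)%N (- y) x|)).
    rewrite lerN2 normrM -[leRHS]mulr1; apply: ler_pM => //; exact: cos_max.
  by rewrite lerNnormlW.
rewrite ge0_integral_blockwise//; last first.
  by move=> j; exact: continuous_measurable_fun.
pose M j : int := (4 ^ j)%N.
(* product-to-sum formulas *)
pose F j v := 8^-1 ^+ j * (wave_prim 0 0 v - wave_prim (M j) 0 v
   + e * (wave_prim (M k) (- y) v
   - 2^-1 * (wave_prim (M j - M k) y v + wave_prim (M j + M k) (- y) v))).
have dF j (x : R) : is_derive x 1 (F j) (q j x).
  have H1 := is_derive_wave_prim 0 0 x.
  have H2 := is_derive_wave_prim (M j) 0 x.
  have H3 := is_derive_wave_prim (M k) (- y) x.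
  have H4 := is_derive_wave_prim (M j - M k) y x.
  have H5 := is_derive_wave_prim (M j + M k) (- y) x.
  rewrite (_ : F j = 8^-1 ^+ j \*: (wave_prim 0 0 - wave_prim (M j) 0
   + e \*: (wave_prim (M k) (- y)
   - 2^-1 \*: (wave_prim (M j - M k) y + wave_prim (M j + M k) (- y))))); last first.
    by apply/funext.
  apply: is_derive_eq; rewrite /GRing.scale/= /q /profile_piece -mulrA; congr (_ * _).
  rewrite /wave !rmorphD/= rmorphN/= -/(M j) -/(M k).
  have -> : ((M j)%:~R - (M k)%:~R) * (pi *+ 2) * x + y =
     ((M j)%:~R * (pi *+ 2) * x + 0) - ((M k)%:~R * (pi *+ 2) * x - y) by ring.
  have -> : ((M j)%:~R + (M k)%:~R) * (pi *+ 2) * x - y =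
     ((M j)%:~R * (pi *+ 2) * x + 0) + ((M k)%:~R * (pi *+ 2) * x - y) by ring.
  rewrite !mul0r !addr0 cos0 [cos (_ - (_ - y))]cosB [cos (_ + (_ - y))]cosD.
  by field.
(* The first constant wave contributes 8^-j. Among the other frequencies only [M j - M k] can
   vanish, and it does so exactly when [j = k], since powers of 4 are distinct. *)
have E j : (\int[leb]_(v in `[j%:R, j.+1%:R]) (q j v)%:E =
    (8^-1 ^+ j - (if j == k then e * (8^-1 ^+ k * cos y / 2) else 0))%:E)%E.
  rewrite (FTC2_is_derive _ (cq j) (dF j)) ?ltr_nat//; congr EFin.
  have B N c := wave_prim_block N c j.
  have M0 i : M i == 0 = false by rewrite /M eqz_nat expn_eq0.
  have MM : M j + M k == 0 = false by rewrite /M -PoszD eqz_nat addn_eq0 expn_eq0.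
  have MB : (M j - M k == 0) = (j == k).
    by rewrite subr_eq0 eqz_nat eqn_exp2l.
  have B1 := B 0 0; have B2 := B (M j) 0; have B3 := B (M k) (- y).
  have B4 := B (M j - M k) y; have B5 := B (M j + M k) (- y).
  rewrite eqxx cos0 in B1; rewrite M0 in B2; rewrite M0 in B3.
  rewrite MB in B4; rewrite MM in B5.
  transitivity (8^-1 ^+ j * ((wave_prim 0 0 j.+1%:R - wave_prim 0 0 j%:R)
    - (wave_prim (M j) 0 j.+1%:R - wave_prim (M j) 0 j%:R)
    + e * ((wave_prim (M k) (- y) j.+1%:R - wave_prim (M k) (- y) j%:R)
    - 2^-1 * ((wave_prim (M j - M k) y j.+1%:R - wave_prim (M j - M k) y j%:R)
      + (wave_prim (M j + M k) (- y) j.+1%:R - wave_prim (M j + M k) (- y) j%:R))))).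
    by rewrite /F; ring.
  rewrite B1 B2 B3 B4 B5; case: eqVneq => [->|_]; first by field.
  by rewrite !(subr0, addr0, mulr0, mulr1).
rewrite (eq_eseriesr (fun j _ => E j)).
apply/cvg_lim => //; apply/cvg_EFin; first by apply: nearW => n; rewrite sumEFin.
rewrite (_ : fine \o _ = fun n => series (geometric 1 8^-1) n -
    \sum_(0 <= j < n) (if j == k then e * (8^-1 ^+ k * cos y / 2) else 0)); last first.
  apply/funext => n /=; rewrite sumEFin /= sumrB /series/=; congr (_ - _).
  by apply: eq_bigr => j _; rewrite mul1r.
apply: cvgB.
  rewrite (_ : 8 / 7 = 1 * (1 - 8^-1)^-1); last by field.
  by apply: cvg_geometric_series; rewrite ger0_norm// invf_lt1// ltr1n.
(* Once [n > k], the second sum contains its only nonzero term and stays constant. *)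
apply: cvg_near_cst; exists k.+1 => // n /= kn.
rewrite -big_mkcond/= big_mkord (big_pred1 (Ordinal kn))//.
Qed.

Lemma integral_envelope_lty : (\int[leb]_v (envelope v)%:E < +oo)%E.
Proof.
rewrite ge0_integral_blockwise; last 2 first.
- by move=> j; exact: measurable_cst.
- exact: envelope_ge0.
rewrite (eq_eseriesr (g := fun j => (2^-1 ^+ j)%:E)); last first.
  move=> j _.
  transitivity (\int[leb]_(v in `[j%:R, j.+1%:R]) cst (2^-1 ^+ j)%:E v)%E => //.
  rewrite integral_cst//= lebesgue_measure_itv/= lte_fin ltr_nat ltnSn.
  by rewrite -EFinD (_ : _ + _ = 1) ?mule1// -natr1 addrC addKr.
rewrite (_ : limn _ = (1 * (1 - 2^-1)^-1)%:E) ?ltry//.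
apply/cvg_lim => //; apply/cvg_EFin; first by apply: nearW => n; rewrite sumEFin.
rewrite (_ : fine \o _ = series (geometric 1 2^-1)); last first.
  by apply/funext => n /=; rewrite sumEFin /series/=; apply: eq_bigr => j _; rewrite /envelope_piece mul1r.
by apply: cvg_geometric_series; rewrite ger0_norm// invf_lt1// ltr1n.
Qed.

End profile.

(** * Fourier coefficients of the normal density *)

Section gaussian.
Context {R : realType}.
Local Notation leb := (@lebesgue_measure R).
Variables (s : R) (s0 : 0 < s).
Local Notation p := (normal_pdf 0 s).

Let s_neq0 : s != 0. Proof. by rewrite gt_eqF. Qed.

Let pE x : p x = normal_peak s * expR (- x ^+ 2 / (s ^+ 2 *+ 2)).
Proof. by rewrite normal_pdfE// /normal_fun subr0. Qed.

Let continuous_p : continuous p. Proof. exact: continuous_normal_pdf. Qed.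

Lemma is_derive_normal_pdf (x : R) : is_derive x 1 p (- x / s ^+ 2 * p x).
Proof.
have -> : p = normal_peak s \*: (fun y => expR (- (s ^+ 2 *+ 2)^-1 * y ^+ 2)).
  by apply/funext => y; rewrite pE/=; congr (_ * expR _); rewrite mulrC mulNr mulrN.
have H : is_derive x 1 (fun y : R => - (s ^+ 2 *+ 2)^-1 * y ^+ 2) (- x / s ^+ 2).
  apply: is_derive_eq; rewrite /GRing.scale/=.
  by rewrite ?(mulr1, mulr0, addr0, add0r, expr1); field.
have := @is_derive1_comp R expR _ x _ _ (is_derive_expR _) H => K.
apply: is_derive_eq; rewrite /= /GRing.scale/=; ring.
Qed.

(** Doubling the standard deviation absorbs the factor [|x|]: the exponent splits off 3x^2/(8s^2),
    and |x| <= s (1 + 3x^2/(8s^2)) <= s exp(3x^2/(8s^2)), where the first inequality follows from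
    (|x| - 2s)^2 >= 0. *)
Lemma normal_pdf_moment (x : R) :
  `|x| * p x <= normal_peak s * s * expR (- x ^+ 2 / ((2 * s) ^+ 2 *+ 2)).
Proof.
rewrite pE mulrCA -mulrA ler_wpM2l ?normal_peak_ge0//.
have -> : - x ^+ 2 / (s ^+ 2 *+ 2) =
    - (3 * x ^+ 2 / (8 * s ^+ 2)) + - x ^+ 2 / ((2 * s) ^+ 2 *+ 2) by field.
rewrite expRD mulrA ler_wpM2r ?expR_ge0// expRN ler_pdivrMr ?expR_gt0//.
apply: (@le_trans _ _ (s * (1 + 3 * x ^+ 2 / (8 * s ^+ 2)))); last first.
  by rewrite ler_pM2l// expR_ge1Dx.
have -> : s * (1 + 3 * x ^+ 2 / (8 * s ^+ 2)) = s + `|x| ^+ 2 / (4 * s) + x ^+ 2 / (8 * s).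
  by rewrite real_normK ?num_real//; field.
rewrite -[leLHS]addr0; apply: lerD; last by rewrite divr_ge0 ?sqr_ge0// mulr_ge0 ?ltW.
rewrite -subr_ge0.
have -> : s + `|x| ^+ 2 / (4 * s) - `|x| = (`|x| - 2 * s) ^+ 2 / (4 * s) by field.
by rewrite divr_ge0 ?sqr_ge0// mulr_ge0 ?ltW.
Qed.

Local Notation B := (`[0, +oo[%classic : set R).

Let mB : measurable B. Proof. exact: measurable_itv. Qed.

Let ip : leb.-integrable setT (EFin \o p). Proof. exact: integrable_normal_pdf. Qed.

(** The majorant of the moment bound, written as a multiple of a normal density so that its
    integrability is inherited. *)
Let dom (x : R) := normal_peak s * s * (normal_peak (2 * s))^-1 * normal_pdf 0 (2 * s) x.

Let s2_neq0 : 2 * s != 0. Proof. by rewrite mulf_neq0. Qed.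

Let domE x : dom x = normal_peak s * s * expR (- x ^+ 2 / ((2 * s) ^+ 2 *+ 2)).
Proof.
rewrite /dom normal_pdfE// /normal_fun subr0 mulrA -(mulrA _ _^-1) mulVf ?mulr1//.
by rewrite gt_eqF// normal_peak_gt0.
Qed.

Let idom : leb.-integrable setT (EFin \o dom).
Proof.
exact: (integrableZl measurableT (normal_peak s * s * (normal_peak (2 * s))^-1)
  (integrable_normal_pdf 0 (2 * s))).
Qed.

Let onB (f : R -> \bar R) : leb.-integrable setT f -> leb.-integrable B f.
Proof. by move=> h; apply: integrableS h. Qed.

Let onBZ (k : R) (f : R -> R) : leb.-integrable setT (EFin \o f) ->
  leb.-integrable B (EFin \o (fun x => k * f x)).
Proof. by move=> h; have := onB (integrableZl measurableT k h); apply: eq_integrable. Qed.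

Let mcos (t : R) : measurable_fun setT (fun x : R => cos (t * x)).
Proof.
rewrite (_ : (fun x => cos (t * x)) = fun v => cos (t * v + 0)).
  by apply: continuous_measurable_fun; exact: continuous_cos_affine.
by apply/funext => v; rewrite addr0.
Qed.

Let msin (t : R) : measurable_fun setT (fun x : R => sin (t * x)).
Proof.
rewrite (_ : (fun x => sin (t * x)) = fun v => sin (t * v + 0)).
  by apply: continuous_measurable_fun; exact: continuous_sin_affine.
by apply/funext => v; rewrite addr0.
Qed.

Let mp : measurable_fun setT p. Proof. exact: measurable_normal_pdf. Qed.

Let icos t : leb.-integrable setT (EFin \o (fun x => p x * cos (t * x))).
Proof.
apply: le_integrable ip => //.
  by apply: measurable_funTS_EFin; exact: measurable_funM.
by move=> x _; rewrite lee_fin normrM ler_piMr// cos_max.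
Qed.

Let isin t : leb.-integrable setT (EFin \o (fun x => x * p x * sin (t * x))).
Proof.
apply: le_integrable idom => //.
  by apply: measurable_funTS_EFin; apply: measurable_funM => //; exact: measurable_funM.
move=> x _; rewrite lee_fin normrM.
rewrite (le_trans (ler_piMr _ (sin_max _)))// domE normrM (ger0_norm (normal_pdf_ge0 _ _ _)).
by rewrite (le_trans (normal_pdf_moment _))// ler_norm.
Qed.

(** Half-line cosine transform of the density; by evenness the full transform is [2 * G]. [K] is
    minus its derivative. *)
Let G (t : R) := \int[leb]_(x in B) (p x * cos (t * x)).
Let K (t : R) := \int[leb]_(x in B) (x * p x * sin (t * x)).

Let is_derive_G (t : R) : is_derive t 1 G (- K t).
Proof.
pose f t x := p x * cos (t * x).
have df (u x : R) : is_derive u 1 (f ^~ x) (- (x * p x * sin (u * x))).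
  have H := is_derive_cos_affine x 0 u.
  rewrite (_ : f ^~ x = p x \*: (fun v => cos (x * v + 0))); last first.
    by apply/funext => v /=; rewrite addr0 mulrC.
  apply: is_derive_eq; rewrite /GRing.scale/= addr0 (mulrC x u); ring.
(* The majorant [dom] does not depend on [t], so any bounded window around [t] serves. *)
have tI : `]t - 1, t + 1[%classic t.
  by rewrite /= in_itv/= ltrBlDr ltrDl ltr01.
have h1 (x : R) : `]t - 1, t + 1[%classic x -> leb.-integrable B (EFin \o f x).
  by move=> _; apply: integrableS (icos x).
have h2 (x y : R) : `]t - 1, t + 1[%classic x -> B y -> derivable (f ^~ y) x 1.
  by move=> _ _; have [] := df x y.
have dom0 x : 0 <= dom x.
  by rewrite domE mulr_ge0 ?expR_ge0// mulr_ge0 ?normal_peak_ge0// ltW.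
have h3 : leb.-integrable B (EFin \o dom) by apply: integrableS idom.
have h4 (x y : R) : `]t - 1, t + 1[%classic x -> B y -> `|partial1of2 f x y| <= dom y.
  move=> _ _; rewrite partial1of2E; have [_ ->] := df x y.
  rewrite normrN normrM (le_trans (ler_piMr _ (sin_max _)))//.
  by rewrite domE normrM (ger0_norm (normal_pdf_ge0 _ _ _)) normal_pdf_moment.
apply: DeriveDef.
  exact: (@derivable_under_integral R _ _ leb f B mB t (t - 1) (t + 1) tI h1 h2 dom dom0 h3 h4).
rewrite -derive1E (@differentiation_under_integral R _ _ leb f B mB t (t - 1) (t + 1) tI h1 h2 dom dom0 h3 h4).
rewrite /K -[RHS]mulN1r -RintegralZl//; last by apply: integrableS (isin t).
apply: eq_Rintegral => x _; rewrite partial1of2E; have [_ ->] := df t x.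
by rewrite mulN1r.
Qed.


Let cvg_p_sin t : p n%:R * sin (t * n%:R) @[n --> \oo] --> (0 : R).
Proof.
(* Adding p(n) <= peak to n p(n) <= peak * s bounds (n + 1) p(n), whence the rate 1/(n + 1). *)
have h n : `|p n%:R * sin (t * n%:R)| <= normal_peak s * (1 + s) * harmonic n.
  rewrite normrM (le_trans (ler_piMr _ (sin_max _)))//.
  rewrite (ger0_norm (normal_pdf_ge0 _ _ _)) /= ler_pdivlMr ?ltr0Sn//.
  rewrite -natr1 mulrDr mulr1 mulrDr mulr1 addrC lerD ?normal_pdf_ub//.
  rewrite mulrC -[X in X * p _]normr_nat (le_trans (normal_pdf_moment _))//.
  apply: ler_piMr; first by rewrite mulr_ge0 ?normal_peak_ge0 ?ltW.
  rewrite -[leRHS]expR0 ler_expR.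
  by rewrite mulNr oppr_le0 divr_ge0 ?sqr_ge0// mulrn_wge0// sqr_ge0.
have c0 : normal_peak s * (1 + s) * harmonic n @[n --> \oo] --> (0 : R).
  by rewrite -[X in _ --> X](mulr0 (normal_peak s * (1 + s))); apply: cvgMr; exact: cvg_harmonic.
apply/norm_cvg0P; apply: (squeeze_cvgr _ _ c0); last exact: cvg_cst.
by apply: nearW => n; rewrite normr_ge0 h.
Qed.

(* Integrating the derivative of [p x * sin (t * x)] over the half-line turns
   [G' = - K] into the differential equation [G' = - s^2 t G]. *)
Let GK t : t * G t = K t / s ^+ 2.
Proof.
(* One formula serves on every block; cutting the half-line at the integers makes the telescoping
   lemma act as the fundamental theorem on [0, +oo). *)
pose q (_ : nat) (x : R) := - x / s ^+ 2 * p x * sin (t * x) + p x * (t * cos (t * x)).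
pose h := blockwise q.
have ih : leb.-integrable setT
    (EFin \o (fun x => - (s ^+ 2)^-1 * (x * p x * sin (t * x)) + t * (p x * cos (t * x)))).
  have := integrableD measurableT (integrableZl measurableT (- (s ^+ 2)^-1) (isin t))
    (integrableZl measurableT t (icos t)).
  by apply: eq_integrable.
have qE j x : q j x = - (s ^+ 2)^-1 * (x * p x * sin (t * x)) + t * (p x * cos (t * x)).
  by rewrite /q; ring.
have hE : EFin \o h = (EFin \o (fun x => - (s ^+ 2)^-1 * (x * p x * sin (t * x)) +
    t * (p x * cos (t * x)))) \_ B.
  apply/funext => x /=; rewrite patchE /h /blockwise.
  have -> : (x \in B) = (0 <= x) by rewrite mem_setE in_itv/= andbT.
  by case: ifP => //; rewrite qE.
have dF (x : R) : is_derive x 1 (fun x => p x * sin (t * x)) (q 0%N x).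
  have H1 := is_derive_normal_pdf x.
  have H2 := is_derive_sin_affine t 0 x.
  rewrite (_ : (fun _ => _) = p * (fun v => sin (t * v + 0))); last first.
    by apply/funext => v; rewrite fctE addr0.
  apply: is_derive_eq; rewrite /GRing.scale/= /q !addr0; ring.
have cq : continuous (q 0%N).
  have c1 : continuous (fun x : R => cos (t * x)).
    rewrite (_ : (fun x => _) = fun v => cos (t * v + 0)); first exact: continuous_cos_affine.
    by apply/funext => v; rewrite addr0.
  have c2 : continuous (fun x : R => sin (t * x)).
    rewrite (_ : (fun x => _) = fun v => sin (t * v + 0)); first exact: continuous_sin_affine.
    by apply/funext => v; rewrite addr0.
  move=> x; apply: cvgD; apply: cvgM => //; last 2 first.
  - exact: continuous_p.
  - by apply: cvgM; [exact: cvg_cst|exact: c1].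
  - apply: cvgM; last exact: continuous_p.
    by apply: cvgM; [apply: cvgN; exact: cvg_id|exact: cvg_cst].
  - exact: c2.
have H : (\int[leb]_x (h x)%:E = (0 - (p 0 * sin (t * 0))%R)%:E)%E.
  apply: (@integral_blockwise_telescope R q h (fun x => p x * sin (t * x))).
  - by rewrite hE; apply/integrable_restrict => //; rewrite setTI; apply: integrableS ih.
  - exact: blockwise_lt0.
  - exact: blockwise_block.
  - by move=> j; exact: (continuous_measurable_fun cq).
  - by move=> j; apply: FTC2_is_derive => //; rewrite ltr_nat.
  - exact: cvg_p_sin.
move: H; rewrite mulr0 sin0 mulr0 subrr.
rewrite (_ : (fun x => (h x)%:E) = EFin \o h)// hE -integral_mkcond.
move=> /(congr1 fine); rewrite -[fine _]/(Rintegral _ _ _) RintegralD//; last 2 first.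
- exact: (onBZ _ (isin t)).
- exact: (onBZ _ (icos t)).
rewrite !RintegralZl//; last 2 first.
- exact: (onB (isin t)).
- exact: (onB (icos t)).
rewrite -/(G t) -/(K t) /= mulNr addrC => /eqP; rewrite subr_eq0 => /eqP ->.
by rewrite mulrC.
Qed.

Let G0E : (\int[leb]_x (p x)%:E = 2 * \int[leb]_(x in B) (p x)%:E)%E.
Proof.
rewrite (ge0_symfun_integralT (normal_pdf_ge0 0 s))//; last first.
  by move=> x /=; rewrite !pE sqrrN.
by congr (_ * _)%E; congr integral; apply/seteqP; split => x /=; rewrite in_itv/= andbT.
Qed.

(** With the integrating factor exp(s^2 t^2 / 2), the equation G' = - s^2 t G makes [H] constant,
    and [H 0] is half the total mass of the density. *)
Let G_gt0 t : 0 < G t.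
Proof.
pose H u := G u * expR (s ^+ 2 / 2 * u ^+ 2).
have dH (u : R) : is_derive u 1 H 0.
  have h1 := is_derive_G u.
  have h2 : is_derive u 1 (fun u : R => s ^+ 2 / 2 * u ^+ 2) (s ^+ 2 * u).
    apply: is_derive_eq; rewrite /GRing.scale/=.
    by rewrite ?(mulr1, mulr0, addr0, add0r, expr1); field.
  have h3 := @is_derive1_comp R expR _ u _ _ (is_derive_expR _) h2.
  rewrite (_ : H = G * (expR \o (fun u : R => s ^+ 2 / 2 * u ^+ 2)))//.
  apply: is_derive_eq; rewrite /GRing.scale/=.
  have -> : K u = s ^+ 2 * (u * G u) by rewrite GK; field.
  by ring.
have E : H t = H 0 by apply: is_derive_0_is_cst.
have H0 : 0 < H 0.
  rewrite /H mulr_gt0 ?expR_gt0// /G.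
  rewrite (@eq_Rintegral _ _ _ leb B p); last by move=> x _; rewrite mul0r cos0 mulr1.
  have := integral_normal_pdf 0 s; rewrite G0E /Rintegral.
  have : (0 <= \int[leb]_(x in B) (p x)%:E)%E.
    by apply: integral_ge0 => x _; rewrite lee_fin normal_pdf_ge0.
  case: (\int[leb]_(x in B) (p x)%:E)%E => [r|//|//] /=.
  - by rewrite lee_fin -EFinM => r0 [r2]; lra.
  - by rewrite gt0_muley// lte_fin.
move: H0; rewrite -E /H pmulr_lgt0//; exact: expR_gt0.
Qed.

(** The weight 1 + cos keeps the integrand nonnegative, so the identity can be carried to the law of
    [xi 0] by the density formula. [kappa] is the characteristic function of the normal law at
    [t]. *)
Lemma integral_normal_pdf_cos (t : R) : exists2 kappa : R, 0 < kappa &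
  (\int[leb]_x ((1 + cos (t * x)) * normal_pdf 0 s x)%:E = (1 + kappa)%:E)%E.
Proof.
exists (2 * G t); first by rewrite mulr_gt0.
have c1 : continuous (fun x : R => cos (t * x)).
  rewrite (_ : (fun x => _) = fun v => cos (t * v + 0)); first exact: continuous_cos_affine.
  by apply/funext => v; rewrite addr0.
rewrite (@ge0_symfun_integralT R (fun x => (1 + cos (t * x)) * p x)); last 3 first.
- move=> x; rewrite mulr_ge0 ?normal_pdf_ge0// -lerBlDl sub0r; exact: cos_geN1.
- move=> x; apply: cvgM; last exact: continuous_p.
  by apply: cvgD; [exact: cvg_cst|exact: c1].
- by move=> x /=; rewrite !pE mulrN cosN sqrrN.
have -> : [set x : R | (0 <= x)%R] = B.
  by apply/seteqP; split => x /=; rewrite in_itv/= andbT.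
have -> : (\int[leb]_(x in B) ((1 + cos (t * x)) * p x)%:E =
    \int[leb]_(x in B) (p x)%:E + \int[leb]_(x in B) (p x * cos (t * x))%:E)%E.
  rewrite -integralD//; last 2 first.
  - exact: (onB ip).
  - exact: (onB (icos t)).
  by apply: eq_integral => x _; rewrite -EFinD mulrDl mul1r [cos _ * _]mulrC.
have -> : (\int[leb]_(x in B) (p x * cos (t * x))%:E = (G t)%:E)%E.
  rewrite /G /Rintegral fineK//.
  by apply: integrable_fin_num => //; exact: (onB (icos t)).
have := integral_normal_pdf 0 s; rewrite G0E.
case: (\int[leb]_(x in B) (p x)%:E)%E => [r| |].
- by rewrite -EFinM => -[r2]; rewrite -EFinD -EFinM mulrDr r2.
- by rewrite gt0_muley// lte_fin.
- by rewrite gt0_muleNy// lte_fin.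
Qed.


End gaussian.

(** * Sobolev regularity of the tensor power *)

Section rV_analysis.
Context {R : realType}.
Local Notation leb := (@lebesgue_measure R).

Definition rV_envelope n (x : 'rV[R]_n) : R := \prod_(i < n) envelope (x ord0 i).

Lemma rV_envelope_ge0 n (x : 'rV[R]_n) : 0 <= rV_envelope x.
Proof. by rewrite prodr_ge0// => i _; exact: envelope_ge0. Qed.

Lemma rV_envelope_le1 n (x : 'rV[R]_n) : rV_envelope x <= 1.
Proof.
by rewrite prodr_ile1// => i _; rewrite envelope_ge0 envelope_le1.
Qed.

Lemma integrable_rV_envelope n :
  (lebesgue_rV n).-integrable setT (fun x => (@rV_envelope n x)%:E).
Proof.
apply/integrableP; split.
  apply/measurable_EFinP; apply: (@measurable_rV_prod R n (fun=> envelope)) => i.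
  exact: measurable_envelope.
under eq_integral do rewrite gee0_abs ?lee_fin ?rV_envelope_ge0//.
rewrite (ge0_integral_rV_prod (fun=> measurable_envelope) (fun=> envelope_ge0)).
rewrite -ge0_fin_numE; last first.
  by apply: prode_ge0 => i _; apply: integral_ge0 => x _; rewrite lee_fin envelope_ge0.
apply: prode_fin_num => i _; rewrite ge0_fin_numE ?integral_envelope_lty//.
by apply: integral_ge0 => x _; rewrite lee_fin envelope_ge0.
Qed.

Lemma integrable_le_envelope n (C : R) (F : 'rV[R]_n -> R) :
  measurable_fun setT F -> (forall x, `|F x| <= C * rV_envelope x) ->
  (lebesgue_rV n).-integrable setT (EFin \o F).
Proof.
move=> mF FC; apply: (@le_integrable _ _ _ (lebesgue_rV n) setT _ _
    (fun x => (C * rV_envelope x)%:E)) => //.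
- exact/measurable_EFinP.
- by move=> x _; rewrite /= lee_fin (le_trans (FC x))// ler_norm.
- have := integrableZl (@measurableT _ 'rV[R]_n) C (integrable_rV_envelope n).
  by apply: eq_integrable.
Qed.

(** Since the envelope is at most 1, its square is at most itself, so one integrable majorant serves
    both exponents. *)
Lemma Lfun_le_envelope n (C : R) (F : 'rV[R]_n -> R) :
  measurable_fun setT F -> (forall x, `|F x| <= C * rV_envelope x) ->
  F \in Lfun (lebesgue_rV n) 1%E /\ F \in Lfun (lebesgue_rV n) 2%:E.
Proof.
move=> mF FC; split.
  by apply/Lfun1_integrable; exact: (integrable_le_envelope mF FC).
rewrite inE/=; apply/andP; split; rewrite inE//=.
rewrite /finite_norm unlock poweR_lty//.
apply: (@le_lt_trans _ _ (\int[lebesgue_rV n]_x (`|C ^+ 2| * rV_envelope x)%:E)%E).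
  apply: ge0_le_integral => //.
  - by move=> x _; exact: poweR_ge0.
  - have m1 : measurable_fun setT (abse \o (EFin \o F)).
      by apply: measurableT_comp => //; exact/measurable_EFinP.
    exact: (measurableT_comp (measurable_poweR 2) m1).
  - apply/measurable_EFinP; apply: measurable_funM => //.
    by have /integrableP[/measurable_EFinP] := integrable_rV_envelope n.
  - move=> x _; rewrite /= lee_fin powR_mulrn//.
    have C0 : 0 <= C * rV_envelope x by rewrite (le_trans _ (FC x)).
    rewrite (@le_trans _ _ ((C * rV_envelope x) ^+ 2))//.
      by rewrite lerXn2r// nnegrE.
    rewrite exprMn ger0_norm ?sqr_ge0// ler_wpM2l ?sqr_ge0//.
    by rewrite expr2 ler_piMr ?rV_envelope_ge0 ?rV_envelope_le1.
have /integrableP[_] : (lebesgue_rV n).-integrable setT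
    (fun x => (`|C ^+ 2| * @rV_envelope n x)%:E).
  have := integrableZl (@measurableT _ 'rV[R]_n) `|C ^+ 2| (integrable_rV_envelope n).
  by apply: eq_integrable.
apply: le_lt_trans; apply: ge0_le_integral => //.
- by move=> x _; rewrite lee_fin mulr_ge0// rV_envelope_ge0.
- apply/measurable_EFinP; apply: measurable_funM => //.
  by have /integrableP[/measurable_EFinP] := integrable_rV_envelope n.
- apply: measurableT_comp => //; apply/measurable_EFinP; apply: measurable_funM => //.
  by have /integrableP[/measurable_EFinP] := integrable_rV_envelope n.
- by move=> x _; rewrite lee_fin ler_norm.
Qed.

(** Fubini with the [i]-th variable innermost. The measure is built by adding one coordinate at a
    time, hence the induction on the dimension; the envelope bound is inherited by slices and gives
    integrability at each stage. *)
Lemma integral_line_eq0 n (i : 'I_n) (C : R) (F : 'rV[R]_n -> R) :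
  measurable_fun setT F -> (forall x, `|F x| <= C * rV_envelope x) ->
  (forall x : 'rV[R]_n,
    \int[leb]_t (F (\row_j (if j == i then t else x ord0 j)))%:E = 0)%E ->
  (\int[lebesgue_rV n]_x (F x)%:E = 0)%E.
Proof.
elim: n i C F => [|n IH] i C F mF FC F0; first by have := ltn_ord i.
have iF := integrable_le_envelope mF FC.
have mFc : measurable_fun setT (fun p : measurableTypeR R * 'rV[R]_n => F (rV_cons p)).
  by apply: measurableT_comp => //; exact: measurable_rV_cons.
have iFc : (leb \x lebesgue_rV n)%E.-integrable setT
    (fun p : measurableTypeR R * 'rV[R]_n => (F (rV_cons p))%:E).
  apply/integrableP; split; first exact/measurable_EFinP.
  have /integrableP[_] := iF.
  rewrite (ge0_integral_pushforward (@measurable_rV_cons R n))//.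
  by apply: measurableT_comp => //; exact/measurable_EFinP.
have -> : (\int[lebesgue_rV n.+1]_x (F x)%:E =
    \int[(leb \x lebesgue_rV n)%E]_p (F (rV_cons p))%:E)%E.
  rewrite (integral_pushforward (@measurable_rV_cons R n))//.
  exact/measurable_EFinP.
have envS t (v : 'rV[R]_n) : rV_envelope (rV_cons (t, v)) = envelope t * rV_envelope v.
  rewrite /rV_envelope big_ord_recl rV_cons0; congr (_ * _).
  by apply: eq_bigr => j _; rewrite rV_consS.
(* If [i] is not the first coordinate, the first one is frozen, its envelope joins the constant, and
   the induction hypothesis applies to the slice. Otherwise the first coordinate is integrated
   innermost. *)
case: (unliftP ord0 i) => [i'|] iE; rewrite {}iE in F0.
  rewrite -integral12_prod_meas1// integral0_eq// => t _; rewrite /fubini_F.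
  apply: (IH i' (C * envelope t) (fun v => F (rV_cons (t, v)))).
  - exact: (measurableT_comp mFc (pair1_measurable t)).
  - by move=> v; rewrite (le_trans (FC _))// envS mulrA.
  - move=> v; rewrite -[RHS](F0 (rV_cons (t, v))); apply: eq_integral => u _.
    congr (F _)%:E; apply/rowP => j; rewrite !mxE.
    case: (unliftP ord0 j) => [j'|] ->; rewrite /=.
      by rewrite mxE (inj_eq lift_inj).
    by [].
rewrite -integral21_prod_meas1// integral0_eq// => v _; rewrite /fubini_G.
rewrite -[RHS](F0 (rV_cons (0, v))); apply: eq_integral => u _.
congr (F _)%:E; apply/rowP => j; rewrite !mxE.
by case: (unliftP ord0 j) => [j'|] ->; rewrite /= ?eqxx.
Qed.

(** The sigma-algebra is generated by the coordinates and not by the open sets, so measurability is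
    obtained by approximation: [f] is the limit of its values at the lower corners of grids of mesh
    1/(m+1), and each approximant is constant on countably many measurable boxes. *)
Lemma continuous_measurable_rV n (f : 'rV[R]_n -> R) :
  continuous f -> measurable_fun setT f.
Proof.
move=> cf.
pose approx (m : nat) (x : 'rV[R]_n) : 'rV[int]_n :=
  \row_i Num.floor (m.+1%:R * x ord0 i).
pose pt (m : nat) (z : 'rV[int]_n) : 'rV[R]_n := \row_i ((z ord0 i)%:~R / m.+1%:R).
apply: (@measurable_fun_cvg _ _ _ _ (fun m x => f (pt m (approx m x)))) => [m|x _].
  move=> _ Y mY; rewrite setTI.
  rewrite (_ : _ @^-1` _ = \bigcup_(z : 'rV[int]_n)
     (if f (pt m z) \in Y then approx m @^-1` [set z] else set0)); last first.
    apply/seteqP; split => [x /= Yx|x [z _]].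
      by exists (approx m x) => //; rewrite mem_set.
    by case: ifPn => // zY /= zE; move: zY; rewrite inE -zE.
  apply: countable_bigcupT_measurable => [|z]; first exact: countableP.
  case: ifPn => // _.
  rewrite (_ : approx m @^-1` _ = \bigcap_(i in [set: 'I_n])
     (rV_coord i @^-1` [set y : measurableTypeR R | (z ord0 i)%:~R <= m.+1%:R * y < (z ord0 i + 1)%:~R])); last first.
    apply/seteqP; split => [x /= <- i _ /=|x /= H].
      by rewrite mxE floor_itv.
    by apply/rowP => i; rewrite mxE; apply: floor_def; exact: H.
  apply: fin_bigcap_measurable => [|i _]; first exact: finite_finset.
  rewrite -[X in measurable X]setTI; apply: measurable_rV_coord => //.
  rewrite (_ : [set y | _] = `[(z ord0 i)%:~R / m.+1%:R, (z ord0 i + 1)%:~R / m.+1%:R[%classic).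
    exact: measurable_itv.
  by apply/seteqP; split => y /=; rewrite in_itv/= ler_pdivrMr ?ltr0Sn// ltr_pdivlMr ?ltr0Sn// mulrC.
apply: (@cvg_comp _ _ _ (fun m => pt m (approx m x)) f _ (nbhs x)); last exact: cf.
apply/cvg_ballP => e e0; near=> m; split => // i j.
rewrite (ord1 i) /ball/= !mxE.
have m0 : 0 < m.+1%:R :> R by rewrite ltr0Sn.
have /andP[h1 h2] := floor_itv (m.+1%:R * x ord0 j).
have Me : m.+1%:R^-1 < e by near: m; exact: (near_infty_natSinv_lt (PosNum e0)).
rewrite intrD -ltrBlDl in h2.
have -> : x ord0 j - (Num.floor (m.+1%:R * x ord0 j))%:~R / m.+1%:R =
    (m.+1%:R * x ord0 j - (Num.floor (m.+1%:R * x ord0 j))%:~R) / m.+1%:R.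
  by field; rewrite gt_eqF.
rewrite normrM ger0_norm ?subr_ge0// ger0_norm ?invr_ge0 ?ler0n//.
by apply: le_lt_trans Me; rewrite ler_piMl ?invr_ge0 ?ler0n// ltW.
Unshelve. all: by end_near. Qed.

Lemma compactly_supported_bounded n (f : 'rV[R]_n -> R) : continuous f ->
  forall S : set 'rV[R]_n, compact S -> (forall x, ~ S x -> f x = 0) ->
  exists M, forall x, `|f x| <= M.
Proof.
move=> cf S cS fS.
have /compact_bounded[M [_ HM]] : compact (f @` S).
  by apply: continuous_compact => //; exact: continuous_subspaceT.
(* [compact_bounded] provides every bound strictly above [M], hence [M + 1]; the 0 covers the points
   outside [S]. *)
exists (Num.max 0 (M + 1)) => x; have [Sx|nSx] := pselect (S x).
  rewrite le_max; apply/orP; right; apply: HM; first by rewrite ltrDl.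
  by exists x.
by rewrite fS// normr0 le_max lexx.
Qed.

Section weak_derivative.
Variable d : nat.

Definition rV_profile (x : 'rV[R]_d) : R := \prod_(i < d) profile (x ord0 i).

Definition rV_profile_grad (x : 'rV[R]_d) : 'rV[R]_d :=
  \row_i (dprofile (x ord0 i) * \prod_(j < d | j != i) profile (x ord0 j)).

Lemma measurable_rV_profile : measurable_fun setT rV_profile.
Proof.
by apply: (@measurable_rV_prod R d (fun=> profile)) => i; exact: measurable_profile.
Qed.

Lemma measurable_rV_profile_grad : measurable_fun setT rV_profile_grad.
Proof.
apply/measurable_fun_rVP => i.
rewrite (_ : _ \o _ = fun x : 'rV[R]_d => dprofile (x ord0 i) *
    \prod_(j < d | j != i) profile (x ord0 j)); last first.
  by apply/funext => x; rewrite /rV_coord /= mxE.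
apply: measurable_funM; first by apply: measurable_rV_compl; exact: measurable_dprofile.
under eq_fun do rewrite big_mkcond/=.
apply: measurable_prod => j _; case: (j != i) => //.
by apply: measurable_rV_compl; exact: measurable_profile.
Qed.

Lemma rV_profile_ge0 x : 0 <= rV_profile x.
Proof. by rewrite prodr_ge0// => i _; exact: profile_ge0. Qed.

Lemma norm_rV_profile_le x : `|rV_profile x| <= 2 ^+ d * rV_envelope x.
Proof.
rewrite ger0_norm ?rV_profile_ge0// /rV_profile /rV_envelope.
rewrite (_ : 2 ^+ d = \prod_(i < d) 2); last by rewrite prodr_const card_ord.
rewrite -big_split/= ler_prod// => i _.
by rewrite profile_ge0 profile_le_envelope.
Qed.

Lemma norm_rV_profile_grad_le x i :
  `|rV_profile_grad x ord0 i| <= pi *+ 2 * 2 ^+ d * rV_envelope x.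
Proof.
rewrite [leRHS](_ : _ = (pi *+ 2 * envelope (x ord0 i)) *
    (2 ^+ d * \prod_(j < d | j != i) envelope (x ord0 j))); last first.
  by rewrite /rV_envelope (bigD1 i)//= mulrACA.
rewrite mxE normrM.
apply: ler_pM => //; first exact: norm_dprofile_le_envelope.
rewrite normr_prod (_ : 2 ^+ d = \prod_(i < d) 2); last by rewrite prodr_const card_ord.
apply: (@le_trans _ _ (\prod_(j < d | j != i) (2 * envelope (x ord0 j)))).
  apply: ler_prod => j _; rewrite normr_ge0 ger0_norm ?profile_ge0//.
  exact: profile_le_envelope.
rewrite big_split/= ler_wpM2r ?prodr_ge0//; first by move=> j _; exact: envelope_ge0.
rewrite [leRHS](bigD1 i)//= ler_peMl ?ler1n// prodr_ge0//.
Qed.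

(** Along a line the integrand is the derivative of profile times [phi], up to the constant factor
    [w]. Each piece of the profile vanishes at both ends of its block, so every block contributes 0;
    the compact support of a test function enters through the bounds [M], which give
    integrability. *)
Lemma rV_profile_line_eq0 (i : 'I_d) (phi : 'rV[R]_d -> R) (M : R) :
  continuous phi -> (forall x, derivable phi x (delta_mx ord0 i)) ->
  continuous (partial i phi) ->
  (forall x, `|phi x| <= M) -> (forall x, `|partial i phi x| <= M) ->
  forall x : 'rV[R]_d, let y t := \row_j (if j == i then t else x ord0 j) in
  (\int[leb]_t (rV_profile (y t) * partial i phi (y t) +
               rV_profile_grad (y t) ord0 i * phi (y t))%:E = 0)%E.
Proof.
move=> cphi dphi cpphi phiM pphiM x y.
pose w := \prod_(j < d | j != i) profile (x ord0 j).
have yi t : y t ord0 i = t by rewrite mxE eqxx.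
have yj t j : j != i -> y t ord0 j = x ord0 j by move=> ji; rewrite mxE (negbTE ji).
have gE t : rV_profile (y t) = profile t * w.
  by rewrite /rV_profile (bigD1 i)//= yi; congr (_ * _); apply: eq_bigr => j /yj ->.
have dgE t : rV_profile_grad (y t) ord0 i = dprofile t * w.
  by rewrite /rV_profile_grad mxE yi; congr (_ * _); apply: eq_bigr => j /yj ->.
have yD t h : y (h + t) = h *: delta_mx ord0 i + y t.
  apply/rowP => j; rewrite !mxE eqxx/=; case: eqVneq => _ /=; first by rewrite mulr1.
  by rewrite mulr0 add0r.
have cy : continuous y.
  move=> t; apply/cvg_ballP => e e0.
  near=> u; have tu : ball t e u by near: u; by apply/nbhs_ballP; exists e.
  split => // k j.
  rewrite /ball/= !mxE; case: ifP => _; last by rewrite subrr normr0.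
  exact: tu.
pose Phi t := phi (y t).
pose dPhi t := partial i phi (y t).
have cPhi : continuous Phi by move=> t; apply: continuous_comp; [exact: cy|exact: cphi].
have cdPhi : continuous dPhi by move=> t; apply: continuous_comp; [exact: cy|exact: cpphi].
have dPhiE (t : R) : is_derive t 1 Phi (dPhi t).
  (* The difference quotient of [phi] on the line is literally the quotient defining the partial
     derivative. *)
  have E : (fun h => h^-1 *: (Phi (h *: (1 : R) + t) - Phi t)) =
      (fun h => h^-1 *: (phi (h *: delta_mx ord0 i + y t) - phi (y t))).
    by apply/funext => h; rewrite /Phi -yD /GRing.scale/= mulr1.
  apply: DeriveDef; first by rewrite /derivable E; exact: dphi.
  by rewrite /derive E.
pose q j t := w * (profile_piece j t * dPhi t + dprofile_piece j t * Phi t).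
pose h t := rV_profile (y t) * partial i phi (y t) + rV_profile_grad (y t) ord0 i * phi (y t).
have hE t : h t = w * (profile t * dPhi t + dprofile t * Phi t).
  by rewrite /h gE dgE /dPhi /Phi; ring.
have cpp j : continuous (@profile_piece R j).
  move=> t; apply/differentiable_continuous/derivable1_diffP.
  by have [] := is_derive_profile_piece j t.
have cq j : continuous (q j).
  move=> t; apply: cvgM; first exact: cvg_cst.
  apply: cvgD; apply: cvgM; [exact: cpp|exact: cdPhi|exact: continuous_dprofile_piece|exact: cPhi].
rewrite -/h.
have mh : measurable_fun setT h.
  rewrite (_ : h = fun t => w * (profile t * dPhi t + dprofile t * Phi t)); last exact/funext.
  apply: measurable_funM => //; apply: measurable_funD; apply: measurable_funM.
  - exact: measurable_profile.
  - exact: continuous_measurable_fun.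
  - exact: measurable_dprofile.
  - exact: continuous_measurable_fun.
have ih : leb.-integrable setT (EFin \o h).
  apply: (@le_integrable _ _ _ leb setT _ _
      (fun t => ((`|w| * (2 * M + pi *+ 2 * M)) * envelope t)%:E)) => //.
  - by apply: measurable_funTS_EFin.
  - move=> t _; rewrite /= lee_fin (le_trans _ (ler_norm _))// hE normrM -mulrA.
    have e1 : `|profile t * dPhi t| <= 2 * M * envelope t.
      rewrite normrM [leRHS]mulrAC; apply: ler_pM => //; last exact: pphiM.
      by rewrite ger0_norm ?profile_ge0 ?profile_le_envelope.
    have e2 : `|dprofile t * Phi t| <= pi *+ 2 * M * envelope t.
      rewrite normrM [leRHS]mulrAC; apply: ler_pM => //; last exact: phiM.
      exact: norm_dprofile_le_envelope.
    by rewrite ler_wpM2l// mulrDl (le_trans (ler_normD _ _))// lerD.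
  - have ie : leb.-integrable setT (EFin \o @envelope R).
      apply/integrableP; split.
        by apply: measurable_funTS_EFin; exact: measurable_envelope.
      under eq_integral do rewrite gee0_abs ?lee_fin ?envelope_ge0//.
      exact: integral_envelope_lty.
    have := integrableZl measurableT (`|w| * (2 * M + pi *+ 2 * M)) ie.
    by apply: eq_integrable.
(* The zero function can play the part of the primitive, as the true one vanishes at all
   integers. *)
rewrite (@integral_blockwise_telescope R q h (fun=> 0) 0)//.
- by rewrite subrr.
- by move=> t t0; rewrite hE /profile /dprofile !blockwise_lt0// !mul0r addr0 mulr0.
- by move=> j t jt; rewrite hE /profile /dprofile !(blockwise_block _ jt).
- by move=> j; exact: continuous_measurable_fun.
- move=> j.
  have dF (t : R) : is_derive t 1 (fun t => w * (profile_piece j t * Phi t)) (q j t).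
    have h1 := is_derive_profile_piece j t.
    have h2 := dPhiE t.
    rewrite (_ : (fun _ => _) = w \*: (@profile_piece R j * Phi))//.
    by apply: is_derive_eq; rewrite /q /GRing.scale/=; ring.
  rewrite (FTC2_is_derive _ (cq j) dF) ?ltr_nat// !profile_piece_nat.
  by rewrite !mul0r !mulr0.
- exact: cvg_cst.
Unshelve. all: by end_near. Qed.

Lemma sobolev_H1_rV_profile : sobolev_H1 rV_profile.
Proof.
have [_ g2] := Lfun_le_envelope measurable_rV_profile norm_rV_profile_le.
split => //; exists rV_profile_grad; split; first exact: measurable_rV_profile_grad.
(* A crude comparison of norms: [d] entries of absolute value at most [B] have Euclidean norm at
   most [d * B], because [d <= d ^ 2]. *)
- pose C := d%:R * (pi *+ 2 * 2 ^+ d) : R.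
  have C0 : 0 <= pi *+ 2 * 2 ^+ d :> R by rewrite mulr_ge0 ?exprn_ge0// ltW// pi2_gt0.
  apply: (proj2 (@Lfun_le_envelope d C (fun x => enorm (rV_profile_grad x)) _ _)).
    apply: (@measurableT_comp _ _ _ _ _ _ (@Num.sqrt R)) => //.
      by apply: continuous_measurable_fun; exact: sqrt_continuous.
    apply: measurable_sum => i; apply: measurable_funX.
    by have /measurable_fun_rVP/(_ i) := measurable_rV_profile_grad.
  move=> x; rewrite ger0_norm ?sqrtr_ge0// /enorm.
  have B0 := rV_envelope_ge0 x.
  rewrite -(ger0_norm (_ : 0 <= C * rV_envelope x)); last first.
    by rewrite mulr_ge0// mulr_ge0.
  rewrite -sqrtr_sqr ler_sqrt ?sqr_ge0//.
  apply: (@le_trans _ _ (\sum_(i < d) (pi *+ 2 * 2 ^+ d * rV_envelope x) ^+ 2)).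
    apply: ler_sum => i _; rewrite -[X in X <= _]real_normK ?num_real//.
    by rewrite lerXn2r ?nnegrE ?(mulr_ge0 C0)// norm_rV_profile_grad_le.
  have -> : C * rV_envelope x = d%:R * (pi *+ 2 * 2 ^+ d * rV_envelope x).
    by rewrite /C -mulrA.
  rewrite sumr_const card_ord -[X in X <= _]mulr_natl [leRHS]exprMn.
  apply: ler_wpM2r; first exact: sqr_ge0.
  by rewrite -natrX ler_nat; case: (d) => // k; rewrite expnS leq_pmulr// expn_gt0.
- move=> i phi [cd cS].
  have [cphi /(_ i)[dphi [cpphi _]]] := cd 1%N.
  pose S := closure [set x | phi x != 0].
  have phiS x : ~ S x -> phi x = 0.
    by move=> nSx; apply/eqP; apply: contra_notT nSx => px; exact: subset_closure.
  (* [S] is the closed support, so [phi] vanishes on a whole neighbourhood of a point outside it. *)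
  have pphiS x : ~ S x -> partial i phi x = 0.
    move=> nSx; have E : \near x, phi x = cst 0 x.
      have : nbhs x (~` S).
        by apply: open_nbhs_nbhs; split => //; exact/closed_openC/closed_closure.
      by apply: filterS => y /phiS.
    by rewrite /partial (near_eq_derive _ E) derive_cst.
  have [M1 phiM1] := compactly_supported_bounded cphi cS phiS.
  have [M2 phiM2] := compactly_supported_bounded cpphi cS pphiS.
  pose M := Num.max M1 M2.
  have phiM x : `|phi x| <= M by rewrite le_max phiM1.
  have pphiM x : `|partial i phi x| <= M by rewrite le_max phiM2 orbT.
  have M0 : 0 <= M by rewrite (le_trans _ (phiM 0)).
  have mphi := continuous_measurable_rV cphi.
  have mpphi := continuous_measurable_rV cpphi.
  have mD : measurable_fun setT (fun x => rV_profile_grad x ord0 i).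
    by have /measurable_fun_rVP/(_ i) := measurable_rV_profile_grad.
  have m1 : measurable_fun setT (fun x => rV_profile x * partial i phi x).
    by apply: measurable_funM => //; exact: measurable_rV_profile.
  have m2 : measurable_fun setT (fun x => rV_profile_grad x ord0 i * phi x).
    exact: measurable_funM.
  have b1 x : `|rV_profile x * partial i phi x| <= 2 ^+ d * M * rV_envelope x.
    by rewrite normrM mulrAC ler_pM// norm_rV_profile_le.
  have b2 x : `|rV_profile_grad x ord0 i * phi x| <= pi *+ 2 * 2 ^+ d * M * rV_envelope x.
    by rewrite normrM [leRHS]mulrAC ler_pM// norm_rV_profile_grad_le.
  have i1 := integrable_le_envelope m1 b1.
  have i2 := integrable_le_envelope m2 b2.
  (* Integration by parts becomes the vanishing of a single integral, to which the line criterion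
     applies. *)
  apply/eqP; rewrite -subr_eq0 opprK -RintegralD//; apply/eqP.
  rewrite /Rintegral (@integral_line_eq0 d i ((2 ^+ d * M) + (pi *+ 2 * 2 ^+ d * M)))//.
  - exact: measurable_funD.
  - by move=> x; rewrite (le_trans (ler_normD _ _))// mulrDl lerD.
  - exact: (rV_profile_line_eq0 cphi dphi cpphi phiM pphiM).
Qed.

End weak_derivative.

End rV_analysis.

(** * A lower bound for the variance by a covariance *)

Section variance.
Local Open Scope ereal_scope.
Context {R : realType} d (T : measurableType d) (P : probability T R).

(** The hypotheses say that [h] has mean 0 and that b = E[N h], in terms of nonnegative integrands.
    Instead of the Cauchy-Schwarz inequality, which would ask for a second moment of [N], a
    pointwise minorant of (N - m)^2 is integrated. *)
Lemma le_integral_sqr_variance (N h : T -> R) (m b : R) :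
  measurable_fun setT N -> measurable_fun setT h ->
  (forall w, 0 <= N w)%R -> (forall w, `|h w| <= 1)%R ->
  \int[P]_w (N w)%:E = m%:E ->
  \int[P]_w (N w * (1 + h w))%:E = (m + b)%:E ->
  \int[P]_w (1 + h w)%:E = 1 ->
  (b ^+ 2)%:E <= 'V_P[N].
Proof.
move=> mN mh N0 h1 EN ENh Eh.
have h1p w : (0 <= 1 + h w)%R.
  by rewrite -lerBlDl sub0r; have := h1 w; rewrite ler_norml => /andP[].
have ige (f : T -> R) (c : R) : measurable_fun setT f -> (forall w, 0 <= f w)%R ->
    \int[P]_w (f w)%:E = c%:E -> P.-integrable setT (EFin \o f).
  move=> mf f0 fc; apply/integrableP; split; first exact/measurable_EFinP.
  by under eq_integral do rewrite /= ger0_norm//; rewrite fc ltry.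
have iN := ige _ _ mN N0 EN.
have iNh : P.-integrable setT (EFin \o (fun w => N w * (1 + h w)))%R.
  apply: (ige _ _ _ _ ENh) => [|w]; last exact: mulr_ge0.
  by apply: measurable_funM => //; exact: measurable_funD.
have ih : P.-integrable setT (EFin \o (fun w => 1 + h w))%R.
  by apply: (ige _ _ _ _ Eh) => //; exact: measurable_funD.
have ic (c : R) : P.-integrable setT (EFin \o (fun=> c)).
  by apply: finite_measure_integrable_cst.
(* This is 2b(N - m)h - b^2, arranged in the integrable quantities at hand. It is at most (N - m)^2
   because (N - m - b h)^2 >= 0 and h^2 <= 1. *)
pose L w := (2 * b * (N w * (1 + h w)) - 2 * b * N w - 2 * b * m * (1 + h w) +
   (2 * b * m - b ^+ 2))%R.
pose Q w := ((N w - m) * (N w - m))%R.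
have iZ (c : R) (f : T -> R) : P.-integrable setT (EFin \o f) ->
    P.-integrable setT (EFin \o (fun w => c * f w))%R.
  by move=> iff; have := integrableZl measurableT c iff; apply: eq_integrable.
have i1 := iZ (2 * b)%R _ iNh; have i2 := iZ (2 * b)%R _ iN.
have i3 := iZ (2 * b * m)%R _ ih.
have i12 := integrableB measurableT i1 i2.
have i123 := integrableB measurableT i12 i3.
have iL : P.-integrable setT (EFin \o L).
  by have := integrableD measurableT i123 (ic (2 * b * m - b ^+ 2)%R); apply: eq_integrable.
have EL : \int[P]_w (L w)%:E = (b ^+ 2)%:E.
  have Z (c : R) (f : T -> R) : P.-integrable setT (EFin \o f) ->
      \int[P]_w (c * f w)%:E = c%:E * \int[P]_w (f w)%:E.
    by move=> iff; rewrite -integralZl.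
  have E1 := integralB measurableT i1 i2; have E2 := integralB measurableT i12 i3.
  have E3 := integralD measurableT i123 (ic (2 * b * m - b ^+ 2)%R).
  apply: (etrans E3); apply: (etrans (congr1 (fun z => z + _)
    (etrans E2 (congr1 (fun z => z - _) E1)))).
  rewrite /= !Z// EN ENh Eh integral_cst//= probability_setT !mule1.
  by rewrite -!EFinM -!EFinB -EFinD; congr EFin; ring.
have LQ w : (L w <= Q w)%R.
  rewrite -subr_ge0; have := sqr_ge0 (N w - m - b * h w)%R.
  have : (0 <= b ^+ 2 * (1 - h w ^+ 2))%R.
    rewrite mulr_ge0 ?sqr_ge0// subr_ge0 -real_normK ?num_real//.
    by rewrite expr_le1// ?normr_ge0.
  by rewrite /L /Q; nra.
have mQ : measurable_fun setT Q.
  by apply: measurable_funM; exact: measurable_funB.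
have -> : 'V_P[N] = \int[P]_w (Q w)%:E.
  by rewrite /variance unlock unlock EN.
rewrite -EL.
(* An infinite variance satisfies the bound at once; a finite one makes [Q] integrable. *)
have [->|Qoo] := eqVneq (\int[P]_w (Q w)%:E) +oo; first exact: leey.
apply: le_integral => //; last by move=> w _; rewrite lee_fin LQ.
apply/integrableP; split; first exact/measurable_EFinP.
under eq_integral do rewrite /= ger0_norm -?expr2 ?sqr_ge0//.
by rewrite ltey.
Qed.

End variance.

(** * Covariance of the linear statistic with a character *)

Section tiling.
Context {R : realType}.
Local Notation leb := (@lebesgue_measure R).

Lemma measurable_indic_itv (i : interval R) :
  measurable_fun setT (\1_([set` i] : set R) : R -> R).
Proof. by apply: measurable_indic; exact: measurable_itv. Qed.

(** [zeta] lives on the closed cube, whereas the translated cells must be half-open to be disjoint;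
    the end point has measure zero. *)
Lemma integral_unit_shift (q : R -> R) (m : int) :
  measurable_fun setT q -> (forall x, 0 <= q x) ->
  (\int[leb]_t (q (m%:~R + t) * \1_(`[0, 1]%classic : set R) t)%:E =
   \int[leb]_u (q u * \1_(`[m%:~R, (m + 1)%:~R[%classic : set R) u)%:E)%E.
Proof.
move=> mq q0.
have patch (i : interval R) : (\int[leb]_u (q u * \1_([set` i] : set R) u)%:E =
    \int[leb]_(u in [set` i]) (q u)%:E)%E.
  rewrite [RHS]integral_mkcond; apply: eq_integral => u _.
  by rewrite patchE indicE; case: ifPn => _; rewrite ?mulr1 ?mulr0.
rewrite patch integral_itv_bndo_bndc; last by apply: measurable_funTS_EFin.
rewrite -patch [RHS](@ge0_integral_affine R 1 m%:~R)//; last 2 first.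
- by apply: measurable_funTS_EFin; apply: measurable_funM => //; exact: measurable_indic_itv.
- by move=> x; rewrite lee_fin mulr_ge0.
rewrite mul1e; apply: eq_integral => t _; congr EFin.
rewrite mul1r (addrC t); congr (_ * _); rewrite !indicE; congr (_%:R).
congr nat_of_bool; apply/idP/idP; rewrite !inE/= !in_itv/= intrD;
  by rewrite lerDl lerD2l.
Qed.

(** The half-open cells with integer corners partition the space, so after the exchange of sum and
    integral exactly one term survives at each point. *)
Lemma esum_unit_cells d (q : 'I_d -> R -> R) :
  (forall i, measurable_fun setT (q i)) -> (forall i x, 0 <= q i x) ->
  (\esum_(n in [set: 'rV[int]_d]) \int[lebesgue_rV d]_z
      (\prod_(i < d) (q i ((n ord0 i)%:~R + z ord0 i) *
                      \1_(`[0, 1]%classic : set R) (z ord0 i)))%:E =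
   \prod_(i < d) \int[leb]_u (q i u)%:E)%E.
Proof.
move=> mq q0.
pose c (m : int) : set R := `[m%:~R, (m + 1)%:~R[%classic.
pose F (n : 'rV[int]_d) (x : 'rV[R]_d) : \bar R :=
  (\prod_(i < d) (q i (x ord0 i) * \1_(c (n ord0 i)) (x ord0 i)))%:E.
have mqc i m : measurable_fun setT (fun u => q i u * \1_(c m) u).
  by apply: measurable_funM => //; exact: measurable_indic_itv.
have q0c i m u : 0 <= q i u * \1_(c m) u by rewrite mulr_ge0.
have mF n : measurable_fun setT (F n).
  apply/measurable_EFinP.
  exact: (@measurable_rV_prod R d (fun i u => q i u * \1_(c (n ord0 i)) u)).
have F0 n x : (0 <= F n x)%E by rewrite lee_fin prodr_ge0.
transitivity (\esum_(n in [set: 'rV[int]_d]) \int[lebesgue_rV d]_x F n x)%E.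
  apply: eq_esum => n _.
  rewrite (@ge0_integral_rV_prod R d (fun i u => q i u * \1_(c (n ord0 i)) u))//.
  rewrite (@ge0_integral_rV_prod R d (fun i t => q i ((n ord0 i)%:~R + t) *
     \1_(`[0, 1]%classic : set R) t)); last 2 first.
  - move=> i; apply: measurable_funM; last exact: measurable_indic_itv.
    by apply: measurableT_comp => //; exact: measurable_funD.
  - by move=> i x; rewrite mulr_ge0.
  by apply: eq_bigr => i _; exact: integral_unit_shift.
rewrite -(ge0_integral_esum (lebesgue_rV d) mF F0).2 -ge0_integral_rV_prod//.
apply: eq_integral => x _.
(* The corner of the only cell containing [x]. *)
pose n0 : 'rV[int]_d := \row_i Num.floor (x ord0 i).
have fl i : c (n0 ord0 i) (x ord0 i) by rewrite /c /= in_itv/= mxE floor_itv.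
transitivity (\esum_(n in [set n0]) F n x)%E.
  rewrite [RHS]esum_mkcond; apply: eq_esum => n _; case: ifPn => //.
  rewrite notin_setE => nn0; rewrite /F; congr EFin.
  have [i ni] : exists i, n ord0 i != n0 ord0 i.
    apply: contra_notP nn0 => H /=; apply/rowP => i; apply/eqP/negPn/negP => ni.
    by apply: H; exists i.
  rewrite (bigD1 i)//= indicE memNset ?mulr0 ?mul0r// => cx.
  move/eqP: ni; apply; rewrite mxE; apply/esym/floor_def.
  by move: cx; rewrite /c/= in_itv.
rewrite esum_set1// /F; congr EFin; apply: eq_bigr => i _.
by rewrite indicE mem_set ?mulr1//; exact: fl.
Qed.

End tiling.

(** * Product form of the Gaussian density and of the unit cube *)

Section gaussian_law.
Context {R : realType}.
Local Notation leb := (@lebesgue_measure R).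

(** Matching exp(-x^2/a) with exp(-x^2/(2s^2)) forces s = sqrt(a/2); the normalizations then
    agree. *)
Lemma gaussian_density_prod d (a : R) (x : 'rV[R]_d) : 0 < a ->
  gaussian_density a x = \prod_(i < d) normal_pdf 0 (Num.sqrt (a / 2)) (x ord0 i).
Proof.
move=> a0; have s0 : 0 < Num.sqrt (a / 2) by rewrite sqrtr_gt0 divr_gt0.
have s2 : Num.sqrt (a / 2) ^+ 2 *+ 2 = a.
  by rewrite sqr_sqrtr ?divr_ge0 ?ltW// -mulr_natr divfK.
have api : 0 < a * pi by rewrite mulr_gt0 ?pi_gt0.
under eq_bigr => i _ do
  rewrite normal_pdfE ?gt_eqF// /normal_fun subr0 s2 /normal_peak -mulrnAl s2.
rewrite big_split/= prodr_const card_ord -expR_sum /gaussian_density; congr (_ * expR _).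
  rewrite exprVn -powR12_sqrt ?ltW// -powR_mulrn ?powR_ge0// -powRrM powRN.
  by congr ((_ `^ _)^-1); rewrite mulrC.
rewrite -mulr_suml sumrN mulNr; congr (- (_ / _)).
by rewrite /enorm sqr_sqrtr// sumr_ge0// => i _; exact: sqr_ge0.
Qed.

End gaussian_law.

Section unit_cube.
Context {R : realType} (d : nat).

Lemma measurable_unit_cube : measurable (@unit_cube R d).
Proof.
rewrite (_ : unit_cube = \bigcap_(i in [set: 'I_d])
    (rV_coord i @^-1` (`[0, 1]%classic : set (measurableTypeR R)))); last first.
  apply/seteqP; split => x /= H i; first by move=> _ /=; rewrite in_itv/=; exact: H.
  by have := H i I; rewrite /= in_itv.
apply: fin_bigcap_measurable => [|i _]; first exact: finite_finset.
rewrite -[X in measurable X]setTI; apply: measurable_rV_coord => //.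
Qed.

Lemma indic_unit_cube (z : 'rV[R]_d) :
  \1_unit_cube z = \prod_(i < d) \1_(`[0, 1]%classic : set R) (z ord0 i) :> R.
Proof.
rewrite indicE; case: (boolP (z \in unit_cube)) => [|zN].
  rewrite inE => zc; rewrite big1// => i _.
  by rewrite indicE mem_set//= in_itv/=; exact: zc.
have [i zi] : exists i, ~~ (0 <= z ord0 i <= 1).
  move: zN; rewrite notin_setE; apply: contra_notP => H i.
  by apply/negPn/negP => zi; apply: H; exists i.
rewrite (bigD1 i)//= indicE memNset ?mul0r//=.
by rewrite in_itv/=; exact/negP.
Qed.

End unit_cube.

(** Stated for any measure that factors on rectangles, since this is what independence says of the
    joint law of [xi n] and [zeta]. *)
Lemma ge0_integral_product d1 d2 (T1 : measurableType d1) (T2 : measurableType d2)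
    (R : realType) (m1 : {sigma_finite_measure set T1 -> \bar R})
    (m2 : {sigma_finite_measure set T2 -> \bar R})
    (m : {measure set (T1 * T2) -> \bar R}) (G : T1 * T2 -> \bar R) :
  (forall A B, measurable A -> measurable B -> m (A `*` B) = m1 A * m2 B)%E ->
  measurable_fun setT G -> (forall p, 0 <= G p)%E ->
  (\int[m]_p G p = \int[m1]_x \int[m2]_y G (x, y))%E.
Proof.
move=> mE mG G0; rewrite -[RHS]/(\int[m1]_x fubini_F m2 G x)%E -fubini_tonelli1//.
(* The instance on products with [lebesgue_measure] declared in the definitions
   shadows the general one in canonical structure inference. *)
apply: (eq_measure_integral
  (lebesgue_integral_fubini_product_measure1__canonical__measure_function_Measure m1 m2)) =>
  X mX _; apply: esym.
exact: product_measure_unique.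
Qed.

(** * Expectation of the linear statistic weighted by a character *)

Section model.
Context {R : realType} (d' : nat).
Local Notation d := d'.+1.
Local Notation leb := (@lebesgue_measure R).
Context {disp : measure_display} {Omega : measurableType disp}.
Variables (a : R) (a0 : 0 < a) (P : probability Omega R).
Variables (xi : 'rV[int]_d -> {RV P >-> 'rV[R]_d}) (zeta : {RV P >-> 'rV[R]_d}).
Hypothesis Hmodel : stationarized_gaussian_lattice a xi zeta.

Lemma ge0_integral_zeta (f : 'rV[R]_d -> \bar R) :
  measurable_fun setT f -> (forall z, 0 <= f z)%E ->
  (\int[distribution P zeta]_z f z =
   \int[lebesgue_rV d]_z (f z * (\1_unit_cube z)%:E))%E.
Proof.
move=> mf f0; apply: ge0_integral_density => //.
- by apply: measurable_indic; exact: measurable_unit_cube.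
- move=> A mA; rewrite integral_indic//; last exact: measurable_unit_cube.
  exact: (etrans (zeta_law Hmodel mA) (congr1 _ (setIC _ _))).
Qed.

(** The lattice sum is integrated term by term, and a term involves one [xi n] together with [zeta]:
    independence is applied to the indices [Some n] and [None]. *)
Lemma ge0_integral_joint n (G : 'rV[R]_d * 'rV[R]_d -> \bar R) :
  measurable_fun setT G -> (forall p, 0 <= G p)%E ->
  (\int[P]_w G (xi n w, zeta w) = \int[distribution P (xi n)]_x
    \int[lebesgue_rV d]_z (G (x, z) * (\1_unit_cube z)%:E))%E.
Proof.
move=> mG G0.
have mpair : measurable_fun setT (fun w => (xi n w, zeta w)).
  by apply/measurable_fun_pairP; split; exact: measurable_funP.
pose pairRV : {RV P >-> ('rV[R]_d * 'rV[R]_d)%type} :=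
  HB.pack (fun w => (xi n w, zeta w)) (isMeasurableFun.Build _ _ _ _ _ mpair).
transitivity (\int[distribution P pairRV]_p G p)%E.
  by rewrite ge0_integral_distribution.
rewrite (@ge0_integral_product _ _ _ _ R (distribution P (xi n)) (distribution P zeta))//.
  apply: eq_integral => x _; rewrite ge0_integral_zeta//.
  exact: (measurableT_comp mG (pair1_measurable x)).
move=> A B mA mB.
have := noise_indep Hmodel (A := fun o => if o is Some _ then A else B)
  [fset Some n; None]%fset.
rewrite big_fsetU1 ?inE//= big_seq_fset1/= => <-; last by case.
rewrite /distribution /pushforward; congr (P _); apply/seteqP; split => w /=.
  by move=> [Aw Bw] o /=; rewrite !inE => /orP[] /eqP ->.
move=> H; split.
  by apply: (H (Some n)); rewrite /= !inE eqxx.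
by apply: (H None); rewrite /= !inE eqxx orbT.
Qed.


Lemma measurable_gaussian_density : measurable_fun setT (@gaussian_density R d a).
Proof.
rewrite (_ : gaussian_density a = fun x : 'rV[R]_d =>
    \prod_(i < d) normal_pdf 0 (Num.sqrt (a / 2)) (x ord0 i)).
  by apply: (@measurable_rV_prod R d (fun=> normal_pdf 0 (Num.sqrt (a / 2)))) => i;
    exact: measurable_normal_pdf.
by apply/funext => x; exact: gaussian_density_prod.
Qed.

Lemma gaussian_density_ge0 (x : 'rV[R]_d) : 0 <= gaussian_density a x.
Proof. by rewrite mulr_ge0 ?powR_ge0 ?expR_ge0. Qed.

(** The density is a product, so the coordinates other than the first integrate to 1. *)
Lemma integral_xi_cos (kappa t : R) :
  (\int[leb]_x ((1 + cos (t * x)) * normal_pdf 0 (Num.sqrt (a / 2)) x)%:E =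
   (1 + kappa)%:E)%E ->
  (\int[distribution P (xi 0)]_x (1 + cos (t * x ord0 ord0))%:E = (1 + kappa)%:E)%E.
Proof.
move=> hk.
have mcos : measurable_fun setT (fun u : R => 1 + cos (t * u)).
  apply: measurable_funD => //; rewrite (_ : (fun u => _) = fun u => cos (t * u + 0)).
    by apply: continuous_measurable_fun; exact: continuous_cos_affine.
  by apply/funext => u; rewrite addr0.
have cos0 (u : R) : 0 <= 1 + cos (t * u) by rewrite -lerBlDl sub0r cos_geN1.
rewrite (@ge0_integral_density _ _ _ (lebesgue_rV d) _ (gaussian_density a)).
- pose p := normal_pdf (0 : R) (Num.sqrt (a / 2)).
  pose q (i : 'I_d) u := (if i == ord0 then 1 + cos (t * u) else 1) * p u.
  transitivity (\int[lebesgue_rV d]_x (\prod_(i < d) q i (x ord0 i))%:E)%E.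
    apply: eq_integral => x _; rewrite -EFinM; congr EFin.
    rewrite gaussian_density_prod// big_split/=; congr (_ * _).
    by rewrite big_ord_recl/= big1 ?mulr1.
  rewrite ge0_integral_rV_prod; last 2 first.
  + move=> i; apply: measurable_funM; last exact: measurable_normal_pdf.
    by case: (i == ord0).
  + by move=> i u; rewrite mulr_ge0 ?normal_pdf_ge0//; case: ifP.
  rewrite big_ord_recl/= big1 ?mule1.
    by rewrite -hk; apply: eq_integral.
  move=> i _; rewrite -[RHS](integral_normal_pdf 0 (Num.sqrt (a / 2))).
  by apply: eq_integral => u _; rewrite /q /= mul1r.
- exact: measurable_gaussian_density.
- exact: gaussian_density_ge0.
- by move=> A mA; rewrite -(xi_law Hmodel 0 mA).
- by apply/measurable_EFinP; exact: (@measurable_rV_compl R d (fun u => 1 + cos (t * u)) ord0).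
- by move=> x; rewrite lee_fin.
Qed.

Section wave_test.
Variables (k : nat) (e : R) (e0 : 0 <= e) (e1 : e <= 1).
Let r : R := 4 ^+ k.

Let r_gt0 : 0 < r. Proof. by rewrite exprn_gt0. Qed.

Let ne : `|e| <= 1. Proof. by rewrite ger0_norm. Qed.

Let weight (i : 'I_d) (u : R) := if i == ord0 then 1 + e * cos (pi *+ 2 * u) else 1.

Let mcos : measurable_fun setT (fun u : R => 1 + e * cos (pi *+ 2 * u)).
Proof.
apply: measurable_funD => //; apply: measurable_funM => //.
rewrite (_ : (fun u => _) = fun u => cos (pi *+ 2 * u + 0)).
  by apply: continuous_measurable_fun; exact: continuous_cos_affine.
by apply/funext => u; rewrite addr0.
Qed.

Let cos0 (u : R) : 0 <= 1 + e * cos u.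
Proof.
rewrite -lerBlDl sub0r; have := ne; have := cos_max u.
move=> h1 h2; have : `|e * cos u| <= 1 by rewrite normrM mulr_ile1.
by rewrite ler_norml => /andP[].
Qed.

Let mweight i : measurable_fun setT (weight i).
Proof. by rewrite /weight; case: (i == ord0). Qed.

Let weight0 i u : 0 <= weight i u.
Proof. by rewrite /weight; case: ifP. Qed.

(** One factor of the unfolded integrand: [s] is a coordinate of the Gaussian displacement, and [u]
    runs over the line covered by [n + zeta]. *)
Let Q (s : R) (i : 'I_d) (u : R) := profile (r^-1 * (s + u)) * weight i u.

Let mQ s i : measurable_fun setT (Q s i).
Proof.
apply: measurable_funM => //; apply: measurableT_comp; first exact: measurable_profile.
by apply: measurable_funM => //; exact: measurable_funD.
Qed.

Let Q0 s i u : 0 <= Q s i u. Proof. by rewrite mulr_ge0// profile_ge0. Qed.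

Let amp (s : R) := r * (8 / 7 - e * (8^-1 ^+ k * cos (pi *+ 2 * s) / 2)).

(** The substitution u = r v - s turns frequency 1 in [u] into frequency r = 4^k in [v], with the
    displacement as phase. The unweighted coordinates are the case e = 0. *)
Let integral_Q s i :
  (\int[leb]_u (Q s i u)%:E = (if i == ord0 then amp s else r * (8 / 7))%:E)%E.
Proof.
rewrite (@ge0_integral_affine R r (- s))//; last 2 first.
- by apply: measurable_funTS_EFin.
- by move=> u; rewrite lee_fin.
have E v : r^-1 * (s + (r * v - s)) = v.
  by rewrite addrC subrK mulKf// gt_eqF.
rewrite /Q /weight /amp; case: ifP => _.
  rewrite EFinM -(integral_profile_wave k (pi *+ 2 * s) ne); congr (_ * _)%E.
  apply: eq_integral => v _; rewrite E /wave; congr (_ * (1 + e * cos _))%:E.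
  by rewrite -pmulrn natrX /r; ring.
rewrite EFinM; congr (_ * _)%E.
have := @integral_profile_wave R k 0 0; rewrite normr0 mul0r subr0 => <-//.
by apply: eq_integral => v _; rewrite E mul0r addr0.
Qed.

Let G (n : 'rV[int]_d) (p : 'rV[R]_d * 'rV[R]_d) : \bar R :=
  (rV_profile (r^-1 *: (map_mx intr n + p.1 + p.2)) *
   (1 + e * cos (pi *+ 2 * p.2 ord0 ord0)))%:E.

Let mG n : measurable_fun setT (G n).
Proof.
apply/measurable_EFinP; apply: measurable_funM.
  apply: measurableT_comp; first exact: measurable_rV_profile.
  apply/measurable_fun_rVP => i.
  rewrite (_ : _ \o _ = fun p : 'rV[R]_d * 'rV[R]_d =>
    r^-1 * ((n ord0 i)%:~R + p.1 ord0 i + p.2 ord0 i)); last first.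
    by apply/funext => p; rewrite /rV_coord /= !mxE.
  apply: measurable_funM => //; apply: measurable_funD; first apply: measurable_funD => //.
    by apply: (measurableT_comp (measurable_rV_coord i)); exact: measurable_fst.
  by apply: (measurableT_comp (measurable_rV_coord i)); exact: measurable_snd.
apply: (@measurableT_comp _ _ _ _ _ _ _ _ (fun p : 'rV[R]_d * 'rV[R]_d => p.2 ord0 ord0) mcos).
by apply: (measurableT_comp (measurable_rV_coord ord0)); exact: measurable_snd.
Qed.

Let G0 n p : (0 <= G n p)%E.
Proof. by rewrite lee_fin mulr_ge0// rV_profile_ge0. Qed.

(** By periodicity the character at [z] equals the character at [n + z], so the whole integrand
    depends on [n + z] and the cells reassemble into the full space. *)
Let esum_G (x : 'rV[R]_d) :
  (\esum_(n in setT) \int[lebesgue_rV d]_z (G n (x, z) * (\1_unit_cube z)%:E) =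
   (amp (x ord0 ord0) * (r * (8 / 7)) ^+ d')%:E)%E.
Proof.
transitivity (\prod_(i < d) \int[leb]_u (Q (x ord0 i) i u)%:E)%E; last first.
  under eq_bigr do rewrite integral_Q.
  rewrite big_ord_recl/= (eq_bigr (fun=> (r * (8 / 7))%:E))//.
  by rewrite prodEFin -EFinM prodr_const card_ord.
rewrite -(@esum_unit_cells R d (fun i => Q (x ord0 i) i))//.
apply: eq_esum => n _; apply: eq_integral => z _.
rewrite /G /= -EFinM; congr EFin; rewrite indic_unit_cube big_split/=; congr (_ * _).
rewrite big_split/=; congr (_ * _).
  by apply: eq_bigr => i _; rewrite !mxE; congr (profile (_ * _)); ring.
rewrite big_ord_recl/= big1 ?mulr1//; congr (1 + e * _).
by rewrite addrC mulrDr mulrzr (periodicz (@cosD2pi R)).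
Qed.

Let integral_esum_G (kappa : R) :
  (\int[distribution P (xi 0)]_x (1 + cos (pi *+ 2 * x ord0 ord0))%:E =
   (1 + kappa)%:E)%E ->
  (\int[P]_w (\esum_(n in setT) G n (xi n w, zeta w)) =
   (r * (8 / 7 - e * (8^-1 ^+ k * kappa / 2)) * (r * (8 / 7)) ^+ d')%:E)%E.
Proof.
move=> hk.
have mGw n : measurable_fun setT (fun w => G n (xi n w, zeta w)).
  apply: measurableT_comp; first exact: mG.
  by apply/measurable_fun_pairP; split; exact: measurable_funP.
rewrite (ge0_integral_esum P mGw _).2//.
pose H n x := (\int[lebesgue_rV d]_z (G n (x, z) * (\1_unit_cube z)%:E))%E.
have mH n : measurable_fun setT (H n).
  apply: (@measurable_fun_fubini_tonelli_F _ _ _ _ _ _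
    (fun p => G n p * (\1_unit_cube p.2)%:E)%E).
  - apply: emeasurable_funM; first exact: mG.
    have mc : measurable_fun setT (fun z : 'rV[R]_d => (\1_unit_cube z : R)%:E).
      by apply/measurable_EFinP; apply: measurable_indic; exact: measurable_unit_cube.
    exact: (measurableT_comp mc measurable_snd).
  - by move=> p; apply: mule_ge0; [exact: G0|rewrite lee_fin].
have H0 n x : (0 <= H n x)%E.
  by apply: integral_ge0 => z _; apply: mule_ge0; [exact: G0|rewrite lee_fin].
(* All [xi n] have the law of [xi 0]; with one common law the sum can go back under the integral,
   where [esum_G] evaluates it. *)
transitivity (\esum_(n in [set: 'rV[int]_d]) \int[distribution P (xi 0)]_x H n x)%E.
  apply: eq_esum => n _; rewrite ge0_integral_joint//.
  apply: eq_measure_integral => A mA _.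
  exact: (etrans (xi_law Hmodel n mA) (esym (xi_law Hmodel 0 mA))).
rewrite -(ge0_integral_esum (distribution P (xi 0)) mH H0).2.
pose A : R := r * (8 / 7) * (r * (8 / 7)) ^+ d'.
pose B : R := e * (r * 8^-1 ^+ k / 2 * (r * (8 / 7)) ^+ d').
have rI0 : 0 <= (r * (8 / 7)) ^+ d' by rewrite exprn_ge0// mulr_ge0// ltW.
have B0 : 0 <= B.
  by rewrite mulr_ge0// mulr_ge0// divr_ge0// mulr_ge0 ?exprn_ge0// ltW.
have AB x : amp (x : R) * (r * (8 / 7)) ^+ d' = A - B * cos (pi *+ 2 * x).
  by rewrite /amp /A /B; ring.
pose mu0 := distribution P (xi 0).
pose f1 (x : 'rV[R]_d) : \bar R := (A - B * cos (pi *+ 2 * x ord0 ord0))%:E.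
pose f2 (x : 'rV[R]_d) : \bar R := (1 + cos (pi *+ 2 * x ord0 ord0))%:E.
have mc : measurable_fun setT (fun x : 'rV[R]_d => cos (pi *+ 2 * x ord0 ord0) : R).
  apply: (@measurable_rV_compl R d (fun u => cos (pi *+ 2 * u)) ord0).
  rewrite (_ : (fun u => _) = fun u => cos (pi *+ 2 * u + 0)).
    by apply: continuous_measurable_fun; exact: continuous_cos_affine.
  by apply/funext => u; rewrite addr0.
have f1E x : f1 x = (\esum_(n in setT) H n x)%E by rewrite /f1 -AB -esum_G.
have f10 x : (0 <= f1 x)%E by rewrite f1E; apply: esum_ge0.
have f20 x : (0 <= f2 x)%E by rewrite lee_fin -lerBlDl sub0r cos_geN1.
have mf1 : measurable_fun setT f1.
  by apply/measurable_EFinP; apply: measurable_funB => //; exact: measurable_funM.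
have mf2 : measurable_fun setT f2.
  by apply/measurable_EFinP; exact: measurable_funD.
have Bf2 : (\int[mu0]_x (B%:E * f2 x) = (B * (1 + kappa))%:E)%E.
  by rewrite ge0_integralZl// hk.
transitivity (\int[mu0]_x f1 x)%E.
  by apply: eq_integral => x _; rewrite f1E.
(* Adding a multiple of 1 + cos cancels the cosine in [f1], so its integral is found from
   nonnegative functions only. *)
have : (\int[mu0]_x f1 x + \int[mu0]_x (B%:E * f2 x) = (A + B)%:E)%E.
  rewrite -ge0_integralD//; last 2 first.
  - by move=> x _; rewrite mule_ge0.
  - exact: emeasurable_funM.
  transitivity (\int[mu0]_x cst (A + B)%:E x)%E.
    apply: eq_integral => x _; rewrite /f1 /f2 -EFinM -EFinD; congr EFin => /=; ring.
  by rewrite integral_cst//= probability_setT mule1.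
rewrite Bf2.
case: (\int[mu0]_x f1 x)%E => [y|//|//].
rewrite -EFinD => -[yE]; congr EFin.
have -> : y = A - B * kappa by rewrite -(addrK (B * (1 + kappa)) y) yE; ring.
by rewrite /A /B; ring.
Qed.

(** The case e = 0 gives the mean of the statistic, and e = 1 adds its covariance with the
    character. *)
Lemma integral_esum_wave (kappa : R) :
  (\int[distribution P (xi 0)]_x (1 + cos (pi *+ 2 * x ord0 ord0))%:E =
   (1 + kappa)%:E)%E ->
  (\int[P]_w (\esum_(n in setT)
      (rV_profile ((4 ^+ k)^-1 *: (map_mx intr n + xi n w + zeta w)) *
       (1 + e * cos (pi *+ 2 * zeta w ord0 ord0)))%:E) =
   (4 ^+ k * (8 / 7 - e * (8^-1 ^+ k * kappa / 2)) * (4 ^+ k * (8 / 7)) ^+ d')%:E)%E.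
Proof. exact: integral_esum_G. Qed.

End wave_test.

End model.

(** * The variance at the scales 4^k *)

Section variance_bound.
Context {R : realType} (d' : nat).
Local Notation d := d'.+1.
Local Notation leb := (@lebesgue_measure R).
Context {disp : measure_display} {Omega : measurableType disp}.
Variables (a : R) (P : probability Omega R).
Variables (xi : 'rV[int]_d -> {RV P >-> 'rV[R]_d}) (zeta : {RV P >-> 'rV[R]_d}).
Hypothesis Hmodel : stationarized_gaussian_lattice a xi zeta.

Lemma measurable_zeta_cos :
  measurable_fun setT (fun w => cos (pi *+ 2 * zeta w ord0 ord0) : R).
Proof.
apply: (@measurableT_comp _ _ _ _ _ _ (fun z : 'rV[R]_d => cos (pi *+ 2 * z ord0 ord0) : R)) => //.
apply: (@measurable_rV_compl R d (fun u => cos (pi *+ 2 * u)) ord0).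
rewrite (_ : (fun u => _) = fun u => cos (pi *+ 2 * u + 0)).
  by apply: continuous_measurable_fun; exact: continuous_cos_affine.
by apply/funext => u; rewrite addr0.
Qed.

Lemma integral_zeta_cos :
  (\int[P]_w (1 + cos (pi *+ 2 * zeta w ord0 ord0))%:E = 1)%E.
Proof.
have mcos : measurable_fun setT (fun u : R => 1 + cos (pi *+ 2 * u)).
  apply: measurable_funD => //; rewrite (_ : (fun u => _) = fun u => cos (pi *+ 2 * u + 0)).
    by apply: continuous_measurable_fun; exact: continuous_cos_affine.
  by apply/funext => u; rewrite addr0.
have cos_ge (u : R) : 0 <= 1 + cos u by rewrite -lerBlDl sub0r cos_geN1.
have mz : measurable_fun setT (fun z : 'rV[R]_d => (1 + cos (pi *+ 2 * z ord0 ord0) : R)%:E).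
  by apply/measurable_EFinP; exact: (@measurable_rV_compl R d (fun u => 1 + cos (pi *+ 2 * u)) ord0).
transitivity (\int[distribution P zeta]_z (1 + cos (pi *+ 2 * z ord0 ord0))%:E)%E.
  by rewrite ge0_integral_distribution// => z; rewrite lee_fin.
rewrite (ge0_integral_zeta Hmodel mz); last by move=> z; rewrite lee_fin.
pose q (i : 'I_d) u := (if i == ord0 then 1 + cos (pi *+ 2 * u) else 1) *
  \1_(`[0, 1]%classic : set R) u : R.
transitivity (\int[lebesgue_rV d]_x (\prod_(i < d) q i (x ord0 i))%:E)%E.
  apply: eq_integral => z _; rewrite -EFinM indic_unit_cube; congr EFin.
  rewrite big_split/=; congr (_ * _).
  by rewrite big_ord_recl/= big1 ?mulr1.
rewrite ge0_integral_rV_prod; last 2 first.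
- move=> i; apply: measurable_funM; last exact: measurable_indic_itv.
  by case: (i == ord0).
- by move=> i u; rewrite mulr_ge0//; case: ifP.
rewrite big_ord_recl/= big1 ?mule1 => [|i _]; last first.
  rewrite /q /=; under eq_integral do rewrite mul1r.
  rewrite integral_indic//= setIT.
  by rewrite lebesgue_measure_itv/= lte01 oppr0 adde0.
rewrite /q /=.
(* Written as a sum of two waves, the integrand is evaluated by [wave_prim_block] on the block of
   index 0. *)
transitivity (\int[leb]_(u in `[0%R, 1%R]) (wave 0 0 u + wave 1 0 u)%:E)%E.
  rewrite [RHS]integral_mkcond; apply: eq_integral => u _.
  rewrite patchE indicE; case: ifPn => _; rewrite ?mulr0// mulr1 /wave.
  by rewrite !mul0r mul1r !addr0 (_ : cos 0 = 1) ?trigo.cos0.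
have cw : continuous (fun u : R => wave 0 0 u + wave 1 0 u).
  by move=> u; apply: cvgD; exact: continuous_wave.
have dF (u : R) : is_derive u 1 (wave_prim 0 0 + wave_prim 1 0) (wave 0 0 u + wave 1 0 u).
  have h1 := is_derive_wave_prim 0 0 u; have h2 := is_derive_wave_prim 1 0 u.
  exact: is_deriveD.
rewrite (FTC2_is_derive ltr01 cw dF).
have h1 := @wave_prim_block R 0 0 0; have h2 := @wave_prim_block R 1 0 0.
rewrite eqxx trigo.cos0 in h1; rewrite (_ : (1 == 0 :> int) = false)// in h2.
congr EFin; rewrite opprD addrACA -[X in X + _]/(wave_prim 0 0 1%:R - wave_prim 0 0 0%:R) h1.
by rewrite -[X in _ + X]/(wave_prim 1 0 1%:R - wave_prim 1 0 0%:R) h2 addr0.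
Qed.

Lemma variance_linear_statistic_ge (k : nat) (kappa : R) :
  (\int[distribution P (xi 0)]_x (1 + cos (pi *+ 2 * x ord0 ord0))%:E =
   (1 + kappa)%:E)%E ->
  (((4 ^+ k * (8^-1 ^+ k * kappa / 2) * (4 ^+ k * (8 / 7)) ^+ d') ^+ 2)%:E <=
   'V_P[linear_statistic xi zeta (@rV_profile R d) (4 ^+ k)])%E.
Proof.
move=> hk.
pose f n w : \bar R :=
  (rV_profile ((4 ^+ k)^-1 *: (map_mx intr n + xi n w + zeta w)))%:E.
pose S w := (\esum_(n in [set: 'rV[int]_d]) f n w)%E.
have f0 n w : (0 <= f n w)%E by rewrite lee_fin rV_profile_ge0.
have S0 w : (0 <= S w)%E by apply: esum_ge0.
have mf n : measurable_fun setT (f n).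
  apply/measurable_EFinP; apply: measurableT_comp; first exact: measurable_rV_profile.
  apply/measurable_fun_rVP => i.
  rewrite (_ : _ \o _ = fun w =>
    (4 ^+ k)^-1 * ((n ord0 i)%:~R + rV_coord i (xi n w) + rV_coord i (zeta w))); last first.
    by apply/funext => w; rewrite /rV_coord /= !mxE.
  apply: measurable_funM => //; apply: measurable_funD; first apply: measurable_funD => //;
    by apply: (measurableT_comp (measurable_rV_coord i)).
have mS : measurable_fun setT S by exact: (ge0_integral_esum P mf f0).1.
have NE : linear_statistic xi zeta (@rV_profile R d) (4 ^+ k) = fine \o S.
  apply/funext => w; rewrite /linear_statistic /=.
  rewrite [X in (_ - X)%E](_ : _ = 0%E) ?sube0; last first.
    apply: esum1 => n _.
    by rewrite (@ge0_funenegE _ _ setT (f ^~ w)) ?inE// => m _; exact: f0.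
  congr fine; apply: eq_esum => n _.
  by rewrite (@ge0_funeposE _ _ setT (f ^~ w)) ?inE// => m _; exact: f0.
have Swave (e : R) : 0 <= e -> e <= 1 ->
    (\int[P]_w (S w * (1 + e * cos (pi *+ 2 * zeta w ord0 ord0))%:E) =
    (4 ^+ k * (8 / 7 - e * (8^-1 ^+ k * kappa / 2)) * (4 ^+ k * (8 / 7)) ^+ d')%:E)%E.
  move=> e0 e1; rewrite -(integral_esum_wave Hmodel k e0 e1 hk).
  apply: eq_integral => w _; rewrite -ge0_esumZr//.
  rewrite -lerBlDl sub0r; have h : `|e * cos (pi *+ 2 * zeta w ord0 ord0)| <= 1.
    by rewrite normrM mulr_ile1// ?cos_max// ger0_norm.
  by move: h; rewrite ler_norml => /andP[].
have ES : (\int[P]_w S w = (4 ^+ k * (8 / 7) * (4 ^+ k * (8 / 7)) ^+ d')%:E)%E.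
  have := Swave 0 (lexx _) ler01; rewrite mul0r subr0 => <-.
  by apply: eq_integral => w _; rewrite mul0r addr0 mule1.
have iS : P.-integrable setT S.
  apply/integrableP; split => //.
  by under eq_integral do rewrite gee0_abs//; rewrite ES ltry.
(* [fine] sends an infinite sum to 0; as [S] has finite mean, this happens on a null set at most. *)
have SE (c : Omega -> R) : measurable_fun setT c -> (forall w, 0 <= c w) ->
    (\int[P]_w (fine (S w) * c w)%:E = \int[P]_w (S w * (c w)%:E))%E.
  move=> mc c0; apply: ge0_ae_eq_integral => //.
  - apply/measurable_EFinP; apply: measurable_funM => //.
    exact: measurableT_comp.
  - by apply: emeasurable_funM => //; exact/measurable_EFinP.
  - by move=> w _; rewrite lee_fin mulr_ge0// fine_ge0.
  - by move=> w _; rewrite mule_ge0// lee_fin.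
  have := integrable_ae measurableT iS; apply: filterS => w /(_ I) Sw _.
  by rewrite EFinM fineK.
have mc := measurable_zeta_cos.
(* The covariance is the negative of the displayed quantity, because the cosine enters the profile
   with a minus sign. *)
rewrite NE -sqrrN.
apply: (@le_integral_sqr_variance R _ _ P (fine \o S)
    (fun w => cos (pi *+ 2 * zeta w ord0 ord0))
    (4 ^+ k * (8 / 7) * (4 ^+ k * (8 / 7)) ^+ d')).
- exact: measurableT_comp.
- exact: mc.
- by move=> w /=; rewrite fine_ge0.
- by move=> w; exact: cos_max.
- rewrite -ES.
  have := SE (fun=> 1) (measurable_cst _) (fun=> ler01).
  under eq_integral do rewrite mulr1.
  by move=> ->; apply: eq_integral => w _; rewrite mule1.
- rewrite (SE (fun w => 1 + cos (pi *+ 2 * zeta w ord0 ord0))).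
  + have := Swave 1 ler01 (lexx _).
    under eq_integral do rewrite mul1r.
    by move=> ->; congr EFin; ring.
  + exact: measurable_funD.
  + by move=> w; rewrite -lerBlDl sub0r cos_geN1.
- exact: integral_zeta_cos.
Qed.

End variance_bound.

(** * Divergence along the scales 4^k *)

Lemma lt_pow4 (R : realType) (x : R) : exists k : nat, x < 4 ^+ k.
Proof.
exists (Num.truncn (Num.max 0 x)).+1.
apply: (@le_lt_trans _ _ (Num.max 0 x)); first by rewrite le_max lexx orbT.
have /andP[_ h] : (Num.truncn (Num.max 0 x))%:R <= Num.max 0 x <
    (Num.truncn (Num.max 0 x)).+1%:R by apply: truncn_itv; rewrite le_max lexx.
by apply: (lt_le_trans h); rewrite -natrX ler_nat ltnW// ltn_expl.
Qed.

(** Every neighbourhood of infinity contains a scale 4^k beyond any given size, so the supremum over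
    it exceeds every bound. *)
Lemma limf_esup_pinfty_unbounded (R : realType) (f : R -> \bar R) (c : R) :
  0 < c -> (forall k : nat, (c * 4 ^+ k)%:E <= f (4 ^+ k)%R)%E ->
  limf_esup f (pinfty_nbhs R) = +oo%E.
Proof.
move=> c0 fc; apply/eqyP => B B0; rewrite limf_esupE.
apply: le_ereal_inf_tmp => _ [V [M [_ MV]] <-].
have [k] := lt_pow4 (Num.max M (B / c)); rewrite gt_max => /andP[Mk Bk].
apply: (@le_trans _ _ (f (4 ^+ k))); last by apply: ereal_sup_ubound; exists (4 ^+ k) => //; exact: MV.
by apply: le_trans (fc k); rewrite lee_fin mulrC -ler_pdivrMr// ltW.
Qed.

Theorem mainTheorem9 (R : realType) (d : nat) (a : R)
    (d_ge2 : (2 <= d)%N) (a_gt0 : 0 < a) :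
  exists g : 'rV[R]_d -> R,
    [/\ g \in Lfun (lebesgue_rV d) 1%E,
        sobolev_H1 g &
        forall (disp : measure_display) (Omega : measurableType disp)
          (P : probability Omega R)
          (xi : 'rV[int]_d -> {RV P >-> 'rV[R]_d})
          (zeta : {RV P >-> 'rV[R]_d}),
          stationarized_gaussian_lattice a xi zeta ->
          limf_esup
            (fun r : R =>
               'V_P[linear_statistic xi zeta g r] * ((r ^+ (d - 2))^-1)%:E)%E
            (pinfty_nbhs R) = +oo%E].
Proof.
exists (@rV_profile R d); split.
- by have [] := Lfun_le_envelope (@measurable_rV_profile R d) (@norm_rV_profile_le R d).
- exact: sobolev_H1_rV_profile.
(* With d = d' + 2 the exponent d - 2 is d', and the variance bound is applied with d' + 1
   unweighted coordinates. *)
- case: d d_ge2 => [|[|d']]// _ disp Omega P xi zeta H.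
  have s0 : 0 < Num.sqrt (a / 2) by rewrite sqrtr_gt0 divr_gt0.
  have [kappa k0 hk] := integral_normal_pdf_cos s0 (pi *+ 2).
  have V := variance_linear_statistic_ge H _ (integral_xi_cos a_gt0 H hk).
  apply: (@limf_esup_pinfty_unbounded _ _ (kappa ^+ 2 / 4)) => [|k].
    by rewrite divr_gt0// exprn_gt0.
  rewrite subn2/=.
  have r0 : 0 < (4 ^+ k : R) by rewrite exprn_gt0.
  apply: (@le_trans _ _ (((4 ^+ k * (8^-1 ^+ k * kappa / 2) *
      (4 ^+ k * (8 / 7)) ^+ d'.+1) ^+ 2)%:E * (((4 ^+ k) ^+ d')^-1)%:E)%E); last first.
    by rewrite lee_wpmul2r ?lee_fin ?invr_ge0 ?exprn_ge0// V.
  rewrite -EFinM lee_fin ler_pdivlMr ?exprn_gt0//.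
  set r : R := 4 ^+ k; set s : R := 8^-1 ^+ k.
  have r1 : 1 <= r by rewrite exprn_ege1// ler1n.
  (* The exact balance 8^-2 * 4^3 = 1. *)
  have sr : s ^+ 2 * r ^+ 3 = 1.
    rewrite /s /r -!exprM mulnC (mulnC k 3) !exprM -exprMn (_ : _ * _ = 1) ?expr1n//.
    by field.
  have rd : r ^+ d'.+1 <= (r * (8 / 7)) ^+ d'.+1.
    by rewrite lerXn2r ?nnegrE ?mulr_ge0 ?(ltW r0)// ler_peMr ?(ltW r0)//; lra.
  have rd1 : 1 <= r ^+ d' by rewrite exprn_ege1.
  apply: (@le_trans _ _ ((r * (s * kappa / 2) * r ^+ d'.+1) ^+ 2)); last first.
    have h0 : 0 <= r * (s * kappa / 2) by rewrite !mulr_ge0 ?exprn_ge0 ?ltW.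
    rewrite lerXn2r ?nnegrE//; last by rewrite ler_wpM2l.
      by rewrite mulr_ge0// exprn_ge0// ltW.
    by rewrite mulr_ge0// exprn_ge0// mulr_ge0// ltW.
  (* Of the two factors r^d', one pays for the normalization and the other is at least 1; the
     remaining [r] makes the quotient unbounded. *)
  have -> : (r * (s * kappa / 2) * r ^+ d'.+1) ^+ 2 =
      (s ^+ 2 * r ^+ 3) * (kappa ^+ 2 / 4 * r * r ^+ d' * r ^+ d').
    by rewrite (exprS r); field.
  rewrite sr mul1r ler_peMr// mulr_ge0 ?exprn_ge0 ?(ltW r0)// mulr_ge0 ?(ltW r0)//.
  by rewrite divr_ge0 ?sqr_ge0.
Qed.
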